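(* Let $\phi$ be a real-valued functional of the covariance matrix. Assume $\|\Sigma^*\|\vee\|\Omega^*\|=O(1)$. Let $A_n$ be a set of precision matrices $\Omega$ (with $\Sigma=\Omega^{-1}$) satisfying $$A_n\subset\{\|\Sigma-\Sigma^*\|\le\delta_n\}$$ for a sequence $\delta_n=o(1)$, and suppose there is a (nonzero) symmetric $p\times p$ matrix $\Phi$ such that $$\sup_{A_n}\sqrt{n}\,\big\|\Sigma^{*1/2}\Phi\Sigma^{*1/2}\big\|_F^{-1}\left|\phi(\Sigma)-\phi(\hat\Sigma)-\mathrm{tr}\big((\Sigma-\hat\Sigma)\Phi\big)\right|=o_P(1).$$ Suppose that for a given prior $\Pi$ the following two conditions hold: 1. $\Pi(A_n|X^n)=1-o_P(1)$; 2. for any fixed $t\in\mathbb{R}$, $$\frac{\int_{A_n}\exp\big(l_n(\Omega_t)\big)\,d\Pi(\Omega)}{\int_{A_n}\exp\big(l_n(\Omega)\big)\,d\Pi(\Omega)}=1+o_P(1),\qquad \Omega_t=\Omega+\frac{\sqrt2\,t}{\sqrt n\,\big\|\Sigma^{*1/2}\Phi\Sigma^{*1/2}\big\|_F}\,\Phi .$$ Then $$\sup_{t\in\mathbb{R}}\left|\Pi\left(\frac{\sqrt n\,\big(\phi(\Sigma)-\phi(\hat\Sigma)\big)}{\sqrt2\,\big\|\Sigma^{*1/2}\Phi\Sigma^{*1/2}\big\|_F}\le t\,\Big|\,X^n\right)-\mathbb{P}(Z\le t)\right|=o_P(1),$$ where $Z\sim N(0,1)$.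
   Context: $X^n=(X_1,\dots,X_n)$ are i.i.d. $N(0,\Sigma^* )$ in $\mathbb{R}^p$, with $\Omega^*=(\Sigma^* )^{-1}$. $\hat\Sigma=\frac1n\sum_{i=1}^nX_iX_i^T$. For a precision matrix $\Omega$ (symmetric positive definite) write $\Sigma=\Omega^{-1}$. The log-likelihood, up to a constant, is $$l_n(\Omega)=\frac n2\log\det(\Omega)-\frac n2\mathrm{tr}(\Omega\hat\Sigma).$$ For a prior $\Pi$ on $\Omega$, the posterior is $\Pi(B|X^n)=\int_B\exp(l_n(\Omega))d\Pi(\Omega)\big/\int\exp(l_n(\Omega))d\Pi(\Omega)$. Asymptotics are as $n,p\to\infty$ jointly ($p=p_n$; $\Sigma^*$, $\Pi$, $\phi$, $\Phi$, $A_n$ may depend on $n$). $O_P,o_P$ refer to the sampling distribution $P_{\Sigma^*}^n$ of the data. $\|\cdot\|$ is the spectral norm, $\|\cdot\|_F$ the Frobenius norm, $a\vee b=\max(a,b)$; $\sup_{A_n}$ is the supremum over $\Omega\in A_n$. *)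

(* Defs.v *)
From HB Require Import structures.
From mathcomp Require Import all_boot all_order all_algebra.
From mathcomp Require Import all_classical all_reals all_analysis.

Set Implicit Arguments.
Unset Strict Implicit.
Unset Printing Implicit Defensive.

Import Order.TTheory GRing.Theory Num.Theory.
Import numFieldNormedType.Exports.

Local Open Scope classical_set_scope.
Local Open Scope ring_scope.

Section matrices.
Variable R : realType.

Definition quad_form p (A : 'M[R]_p) (x : 'cV[R]_p) : R := (x^T *m A *m x) 0 0.

Definition posdefmx p : set 'M[R]_p :=
  [set A | A^T = A /\ forall x : 'cV[R]_p, x != 0 -> 0 < quad_form A x].

Definition possemidefmx p : set 'M[R]_p :=
  [set A | A^T = A /\ forall x : 'cV[R]_p, 0 <= quad_form A x].

(* The unique symmetric positive semidefinite square root; meant for positive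
   semidefinite [A], the value being unspecified when no root exists. *)
Definition mxsqrt p (A : 'M[R]_p) : 'M[R]_p :=
  xget 0 [set S | possemidefmx S /\ S *m S = A].

(* On column vectors this is the Euclidean norm. The library norm [`|A|] on
   matrices is the largest absolute value of an entry, hence is not used. *)
Definition frobenius_norm m n (A : 'M[R]_(m, n)) : R :=
  Num.sqrt (\sum_i \sum_j A i j ^+ 2).

Definition spectral_norm m n (A : 'M[R]_(m, n)) : R :=
  sup [set frobenius_norm (A *m x) | x in [set x : 'cV[R]_n | frobenius_norm x <= 1]].

End matrices.

(* 'M[R]_(m, n) with its Borel sigma-algebra. *)
Notation borel_mx R m n := (g_sigma_algebraType (@open 'M[R]_(m, n))).

Section sampling.
Context (R : realType) (d : measure_display) (T : measurableType d).
Variable P : probability T R.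

(* X ~ N(0, Sigma) for positive definite Sigma: every nontrivial linear
   combination of the coordinates is univariate normal. The second parameter
   of [normal_prob] is the standard deviation. *)
Definition centered_gaussian p (Sigma : 'M[R]_p) (X : T -> 'cV[R]_p) : Prop :=
  measurable_fun setT (X : T -> borel_mx R p 1) /\
  forall a : 'cV[R]_p, a != 0 -> forall B : set R, measurable B ->
    P [set w | B ((a^T *m X w) 0 0)] =
    normal_prob 0 (Num.sqrt (quad_form Sigma a)) B.

(* Taking some of the [B i] to be [setT] gives the product rule for every
   subfamily. *)
Definition mutually_independent n p (X : 'I_n -> T -> 'cV[R]_p) : Prop :=
  forall B : 'I_n -> set (borel_mx R p 1), (forall i, measurable (B i)) ->
    P [set w | forall i, B i (X i w)] =
    (\prod_(i < n) P [set w | B i (X i w)])%E.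

Definition iid_gaussian n p (Sigma : 'M[R]_p) (X : 'I_n -> T -> 'cV[R]_p) : Prop :=
  (forall i, centered_gaussian Sigma (X i)) /\ mutually_independent X.

Definition outer_probability (A : set T) : \bar R :=
  ereal_inf [set P E | E in [set E | measurable E /\ A `<=` E]].

Lemma outer_probabilityE (A : set T) : measurable A -> outer_probability A = P A.
Proof.
move=> mA; apply/eqP; rewrite eq_le; apply/andP; split.
  by apply: ereal_inf_lbound; exists A => //; split.
by apply: le_ereal_inf_tmp => _ [E [mE AE] <-]; apply: le_measure; rewrite ?inE.
Qed.

End sampling.

(* Z_n = o_P(1). The suprema considered here are taken over uncountable families
   and need not be measurable, whence the outer probability; they may also be
   infinite, whence the extended real values. *)
Definition oP1 (R : realType) (d : nat -> measure_display)
    (T : forall n, measurableType (d n)) (P : forall n, probability (T n) R)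
    (Z : forall n, T n -> \bar R) : Prop :=
  forall eps : R, 0 < eps ->
    (fun n => outer_probability (P n) [set w | (eps%:E < `|Z n w|)%E]) @ \oo
      --> 0%E.

Section posterior.
Variable R : realType.

Definition sample_covariance n p (x : 'I_n -> 'cV[R]_p) : 'M[R]_p :=
  n%:R^-1 *: \sum_(i < n) x i *m (x i)^T.

(* [S] stands for the sample covariance matrix. [ln] is 0 on nonpositive
   numbers, so only the values at positive definite [Omega] are meaningful. *)
Definition loglik (n : nat) p (S Omega : 'M[R]_p) : R :=
  n%:R / 2 * ln (\det Omega) - n%:R / 2 * \tr (Omega *m S).

(* Integral over [A] of exp (l_n (f Omega)) with respect to the prior. *)
Definition lik_integral (n : nat) p (Pi : probability (borel_mx R p p) R)
    (S : 'M[R]_p) (f : 'M[R]_p -> 'M[R]_p) (A : set 'M[R]_p) : \bar R :=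
  (\int[Pi]_(Omega in (A : set (borel_mx R p p)))
     (expR (loglik n S (f Omega)))%:E)%E.

(* Posterior mass of a set [B] of precision matrices. Where the normalizing
   integral is infinite (possible for singular [S]) [fine] sends it to 0 and
   the value is 0, so "posterior mass close to 1" fails there. *)
Definition posterior (n : nat) p (Pi : probability (borel_mx R p p) R)
    (S : 'M[R]_p) (B : set 'M[R]_p) : R :=
  fine (lik_integral n Pi S id B) / fine (lik_integral n Pi S id (@posdefmx R p)).

Definition std_normal_cdf (t : R) : R := fine (normal_prob 0 1 [set x : R | x <= t]).

End posterior.

(* Main.v *)
Require Import Defs.
From mathcomp Require Import all_boot all_order all_algebra.
From mathcomp Require Import all_classical all_reals all_analysis.
From mathcomp Require Import measurable_realfun complex ring lra.

Import Order.TTheory GRing.Theory Num.Theory.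
Import numFieldNormedType.Exports.

Set Implicit Arguments.
Unset Strict Implicit.
Unset Printing Implicit Defensive.

Local Open Scope classical_set_scope.
Local Open Scope ring_scope.

(** A Bernstein-von Mises theorem for a functional [phi] of a covariance matrix.

    Write [S] for the sample covariance, [Sigma] for the inverse of [Omega],
    [s] for the Frobenius norm of [SigmaStar^(1/2) Phi SigmaStar^(1/2)], and
      [V(Omega) = sqrt n * tr ((Sigma - S) Phi) / (sqrt 2 * s)].

    Local expansion. Let [r] be the square root of [Sigma] and [d_i] the (real)
    eigenvalues of the symmetric matrix [r Phi r]. With
    [h = sqrt 2 * t / (sqrt n * s)] one has
    [det (Omega + h Phi) = det Omega * prod_i (1 + h d_i)], where
    [sum_i d_i = tr (Sigma Phi)] and
    [sum_i d_i^2 = tr (Sigma Phi Sigma Phi) = (1 + o(1)) s^2], because [Sigma] is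
    close to [SigmaStar] on [A_n] ([trace_quadratic_perturb]). Every [h d_i] is
    [O (1 / sqrt n)], so the second order Taylor formula of the logarithm gives,
    uniformly over [A_n],
      [l_n (Omega_t) - l_n (Omega) = t * V(Omega) - t^2 / 2 + o(1)]
    ([loglik_shift], [loglik_expansion]). Hence the ratio of integrals in the
    second condition on the prior is, up to a factor [1 + o(1)],
    [exp (- t^2 / 2)] times the moment generating function at [t] of [V] under the
    posterior conditioned on [A_n]; for every fixed [t] this moment generating
    function converges in probability to [exp (t^2 / 2)], that of [N(0,1)]
    ([restricted_mgf_close]).

    From moment generating functions to distribution functions. The convergence
    holds for each [t] separately and only in probability, so the continuity
    theorem is used in a quantitative form ([mgf_determines_cdf]): for every [eps]
    there are finitely many [t] and a [delta] such that any distribution whose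
    moment generating function is [delta]-close to the Gaussian one at these [t]
    has a distribution function uniformly [eps]-close to the Gaussian one. For
    this it suffices to approximate step functions by linear combinations of
    exponentials up to errors [eta * exp (a |x|)], which have small mean. Such
    weighted approximation can be iterated with different [a]
    ([exp_closure_determined]): difference quotients of exponentials give
    polynomials, Taylor polynomials give cosines, products of cosines are sums of
    cosines, and an odd polynomial iterated on a sine of long period gives a
    square wave; outside one period the weight absorbs the error
    ([step_approximation]).

    Conclusion. Replacing [V] by the normalized difference of [phi] moves the
    distribution function by at most the linearization error, and passing from
    the conditioned posterior to the posterior by at most the mass outside [A_n]
    ([posterior_cdf_close]). Both are small off events whose outer probability
    vanishes. *)

(** * Real symmetric matrices *)

(** The complex spectral theorem applies to a real symmetric matrix, which is
    Hermitian, and its eigenvalues are real. The change of basis stays complex: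
    only traces, determinants and polynomials of [M] are read off it, and these
    descend to the real field. *)
Lemma symmetric_diagonalization (R : rcfType) p (M : 'M[R]_p) : M^T = M ->
  exists (U : 'M[R[i]]_p) (d : 'rV[R]_p), U \in unitmx /\
    map_mx (real_complex R) M =
      invmx U *m diag_mx (map_mx (real_complex R) d) *m U.
Proof.
move=> MT; set Mc := map_mx (real_complex R) M.
have Mreal : Mc \is a mxOver Num.real.
  by apply/mxOverP => i j; rewrite mxE; apply/complex_realP; exists (M i j).
have Msym : Mc \is symmetricmx.
  by apply/is_hermitianmxP; rewrite expr0 scale1r map_mx_id // map_trmx MT.
have Mherm := realsym_hermsym Msym Mreal.
have /hermitian_normalmx/orthomx_spectralP Meq := Mherm.
have dreal := hermitian_spectral_diag_real Mherm.
exists (spectralmx Mc), (map_mx (@complex.Re R) (spectral_diag Mc)).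
split; first exact: spectral_unit.
rewrite -map_mx_comp [X in _ *m diag_mx X *m _](_ : _ = spectral_diag Mc) //.
apply/matrixP => i j; rewrite mxE /=.
have /mxOverP/(_ i j)/complex_realP[k ->] := dreal.
by [].
Qed.

Section Diagonalized.
Context (R : rcfType) (p : nat) (M : 'M[R]_p) (U : 'M[R[i]]_p) (d : 'rV[R]_p).
Hypothesis Uu : U \in unitmx.
Hypothesis Meq : map_mx (real_complex R) M =
  invmx U *m diag_mx (map_mx (real_complex R) d) *m U.

Lemma det_1DZ_diagonalized h : \det (1%:M + h *: M) = \prod_i (1 + h * d 0 i).
Proof.
apply: (fmorph_inj (real_complex R)).
rewrite -det_map_mx map_mxD map_mx1 map_mxZ Meq.
set D := diag_mx _; rewrite (_ : _ + _ = invmx U *m (1%:M + h%:C%C *: D) *m U).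
  rewrite !det_mulmx mulrAC -det_mulmx mulVmx // det1 mul1r.
  rewrite -linearZ /= -diag_const_mx -raddfD /= det_diag rmorph_prod.
  by apply: eq_bigr => i _; rewrite !mxE rmorphD rmorphM rmorph1.
by rewrite mulmxDr mulmxDl mulmx1 mulVmx // -scalemxAr -scalemxAl.
Qed.

Lemma trace_diagonalized : \tr M = \sum_i d 0 i.
Proof.
apply: (fmorph_inj (real_complex R)).
rewrite -trace_map_mx Meq mxtrace_mulC mulmxA mulmxV // mul1mx mxtrace_diag.
by rewrite rmorph_sum; apply: eq_bigr => i _; rewrite mxE.
Qed.

Lemma trace_sqr_diagonalized : \tr (M *m M) = \sum_i d 0 i ^+ 2.
Proof.
apply: (fmorph_inj (real_complex R)).
rewrite -trace_map_mx map_mxM Meq !mulmxA.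
rewrite mulmxK // mxtrace_mulC !mulmxA mulmxV // mul1mx mulmx_diag mxtrace_diag.
by rewrite rmorph_sum; apply: eq_bigr => i _; rewrite !mxE rmorphXn expr2.
Qed.

End Diagonalized.

Lemma interpolation_exists (F : fieldType) (s : seq F) (f : F -> F) :
  exists q : {poly F}, forall x, x \in s -> q.[x] = f x.
Proof.
elim: s => [|x s [q qP]]; first by exists 0.
have [xs|xs] := boolP (x \in s).
  by exists q => y; rewrite inE => /predU1P[->|]; exact: qP.
set w := \prod_(y <- s) ('X - y%:P).
have wx : w.[x] != 0 by rewrite -[_ == 0]/(root w x) root_prod_XsubC.
exists (q + ((f x - q.[x]) / w.[x]) *: w) => y.
rewrite inE => /predU1P[->|ys]; rewrite !hornerE; first by rewrite divfK // subrKC.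
have /rootP -> : root w y by rewrite root_prod_XsubC.
by rewrite mulr0 addr0 qP.
Qed.

(** Keeps square roots real and symmetric when they are built as polynomials in
    the matrix. *)
Lemma horner_mx_symmetric (R : comNzRingType) n (M : 'M[R]_n.+1) (q : {poly R}) :
  M^T = M -> (horner_mx M q)^T = horner_mx M q.
Proof.
move=> MT; elim/poly_ind: q => [|q c IH]; first by rewrite rmorph0 trmx0.
rewrite rmorphD rmorphM /= horner_mx_X horner_mx_C linearD /= tr_scalar_mx.
congr (_ + _); rewrite -mulmxE trmx_mul IH MT.
by apply/esym/comm_horner_mx.
Qed.

Section Root.
Context (R : realType).

Lemma quad_formE p (A : 'M[R]_p) x : quad_form A x = (x^T *m (A *m x)) 0 0.
Proof. by rewrite /quad_form mulmxA. Qed.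

Lemma cV_dotE p (x : 'cV[R]_p) : (x^T *m x) 0 0 = \sum_i x i 0 ^+ 2.
Proof. by rewrite !mxE; apply: eq_bigr => i _; rewrite mxE expr2. Qed.

Lemma cV_dot_eq0 p (x : 'cV[R]_p) : ((x^T *m x) 0 0 == 0) = (x == 0).
Proof.
rewrite cV_dotE psumr_eq0 => [|i _]; last exact: sqr_ge0.
apply/allP/eqP => [x0|-> i _ /=]; last by rewrite mxE expr0n.
apply/colP => i; rewrite mxE; apply/eqP.
by rewrite -sqrf_eq0; apply: x0; rewrite mem_index_enum.
Qed.

Lemma posdefmx_unit p (A : 'M[R]_p) : posdefmx A -> A \in unitmx.
Proof.
move=> [AT Apos]; rewrite unitmxE unitfE; apply/det0P => -[v v0 vA0].
have := Apos v^T; rewrite trmx_eq0 => /(_ v0).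
by rewrite /quad_form trmxK vA0 mul0mx mxE ltxx.
Qed.

Lemma posdefmx_psd p (A : 'M[R]_p) : posdefmx A -> possemidefmx A.
Proof.
move=> [AT Apos]; split=> // x; have [->|/Apos/ltW//] := eqVneq x 0.
by rewrite quad_formE !mulmx0 mxE.
Qed.

(** A complex basis of eigenvectors would only give a complex square root. Taking
    a real polynomial [r] with values [d_i ^ (1/4)] at the eigenvalues, the matrix
    [r (M) ^ 2] is real, is positive semidefinite as the square of a symmetric
    matrix, and squares to [M] since [r ^ 4 - X] vanishes on the spectrum. *)
Lemma psd_sqrt_exists p (M : 'M[R]_p) : possemidefmx M ->
  exists S : 'M[R]_p, possemidefmx S /\ S *m S = M.
Proof.
case: p M => [|n] M [MT Mpsd].
  exists M; split=> //; by rewrite [M]flatmx0 mulmx0.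
have [U [d [Uu Meq]]] := symmetric_diagonalization MT.
have annih q : (forall i, q.[d 0 i] = 0) -> horner_mx M q = 0.
  move=> q0; apply: (@map_mx_inj _ _ (real_complex R)).
  rewrite map_mx0 map_horner_mx Meq (horner_mx_uconjC _ _ Uu) horner_mx_diag.
  rewrite -map_mx_comp [map_mx _ d](_ : _ = 0) ?linear0 ?mulmx0 ?mul0mx //.
  by apply/matrixP => i j; rewrite !mxE /= horner_map /= ord1 q0 rmorph0.
have dge0 i : 0 <= d 0 i.
  (* A negative eigenvalue would make the positive definite [1 + h M] singular
     for this positive [h]. *)
  rewrite leNgt; apply/negP => di0; set h := - (d 0 i)^-1.
  have h0 : 0 < h by rewrite oppr_gt0 invr_lt0.
  have : posdefmx (1%:M + h *: M).
    split; first by rewrite linearD /= trmx1 linearZ /= MT.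
    move=> x x0; rewrite quad_formE mulmxDl mul1mx mulmxDr mxE -scalemxAl -scalemxAr.
    rewrite [X in _ + X]mxE mulmxA; apply: ltr_pwDl; last first.
      by apply: mulr_ge0; [exact: ltW|exact: Mpsd].
    rewrite lt_def cV_dot_eq0 x0 cV_dotE; apply: sumr_ge0 => *; exact: sqr_ge0.
  move/posdefmx_unit; rewrite unitmxE unitfE (det_1DZ_diagonalized Uu Meq).
  by move/prodf_neq0/(_ i isT); rewrite mulNr mulVf ?subrr ?eqxx // lt_eqF.
have [r rP] := interpolation_exists [seq d 0 i | i : 'I_n.+1] (fun x => Num.sqrt (Num.sqrt x)).
have {}rP i : r.[d 0 i] = Num.sqrt (Num.sqrt (d 0 i)) by apply/rP/map_f; rewrite mem_enum.
set T := horner_mx M r.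
have TT : T^T = T by exact: horner_mx_symmetric.
exists (T *m T); split.
  split; first by rewrite trmx_mul TT.
  move=> x; rewrite quad_formE -mulmxA mulmxA -{1}TT -trmx_mul cV_dotE.
  by apply: sumr_ge0 => *; exact: sqr_ge0.
have := annih (r ^+ 2 * r ^+ 2 - 'X).
rewrite rmorphB rmorphM rmorphXn /= horner_mx_X expr2 -/T => rM.
apply/eqP; rewrite -subr_eq0; apply/eqP/rM => i.
rewrite hornerD hornerN hornerX !hornerM rP -!expr2.
by rewrite !sqr_sqrtr ?sqrtr_ge0 // subrr.
Qed.

Lemma mxsqrtP p (M : 'M[R]_p) : possemidefmx M ->
  possemidefmx (mxsqrt M) /\ mxsqrt M *m mxsqrt M = M.
Proof.
move=> /psd_sqrt_exists[S SP].
exact: (@xgetPex _ 0 [set S | possemidefmx S /\ S *m S = M] (ex_intro _ S SP)).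
Qed.

End Root.

(** * Frobenius and spectral norms *)

Section Norms.
Context (R : realType).

Lemma frobenius_norm_ge0 m n (A : 'M[R]_(m, n)) : 0 <= frobenius_norm A.
Proof. exact: sqrtr_ge0. Qed.

Lemma frobenius_norm_sqr m n (A : 'M[R]_(m, n)) :
  frobenius_norm A ^+ 2 = \tr (A^T *m A).
Proof.
rewrite sqr_sqrtr; last by do 2!(apply: sumr_ge0 => ? _); exact: sqr_ge0.
rewrite exchange_big; apply: eq_bigr => j _; rewrite mxE; apply: eq_bigr => i _.
by rewrite mxE expr2.
Qed.

Lemma frobenius_norm_eq0 m n (A : 'M[R]_(m, n)) : (frobenius_norm A == 0) = (A == 0).
Proof.
apply/eqP/eqP => [A0|->]; last first.
  by apply/eqP; rewrite -sqrf_eq0 frobenius_norm_sqr mulmx0 linear0.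
apply/matrixP => i j; rewrite mxE; apply/eqP.
have : frobenius_norm A ^+ 2 == 0 by rewrite A0 expr0n.
rewrite sqr_sqrtr; last by do 2!(apply: sumr_ge0 => ? _); exact: sqr_ge0.
rewrite psumr_eq0 => [|? _]; last by apply: sumr_ge0 => *; exact: sqr_ge0.
move=> /allP/(_ i); rewrite mem_index_enum => /(_ isT) /=.
rewrite psumr_eq0 => [|? _]; last exact: sqr_ge0.
by move=> /allP/(_ j); rewrite mem_index_enum sqrf_eq0 => /(_ isT).
Qed.

Lemma frobenius_norm0 m n : frobenius_norm (0 : 'M[R]_(m, n)) = 0.
Proof. by apply/eqP; rewrite frobenius_norm_eq0. Qed.

Lemma frobenius_norm_tr m n (A : 'M[R]_(m, n)) :
  frobenius_norm A^T = frobenius_norm A.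
Proof.
rewrite /frobenius_norm exchange_big /=; congr Num.sqrt.
by do 2!(apply: eq_bigr => ? _); rewrite mxE.
Qed.

Lemma frobenius_normZ m n c (A : 'M[R]_(m, n)) :
  frobenius_norm (c *: A) = `|c| * frobenius_norm A.
Proof.
apply/eqP; rewrite -(@eqrXn2 _ 2) ?mulr_ge0 ?frobenius_norm_ge0 //.
rewrite exprMn real_normK ?num_real // !frobenius_norm_sqr.
by rewrite -scalemxAr [(c *: A)^T]linearZ /= -scalemxAl !linearZ /= mulrA -expr2.
Qed.

Lemma frobenius_CauchySchwarz m n (A B : 'M[R]_(m, n)) :
  `|\tr (A^T *m B)| <= frobenius_norm A * frobenius_norm B.
Proof.
rewrite -(@ler_pXn2r _ 2) ?nnegrE ?mulr_ge0 ?frobenius_norm_ge0 //.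
rewrite exprMn real_normK ?num_real //.
set a := frobenius_norm A ^+ 2; set b := frobenius_norm B ^+ 2.
set c := \tr _.
have cE : \tr (B^T *m A) = c by rewrite -mxtrace_tr trmx_mul trmxK.
have [/eqP|b0] := boolP (b == 0).
  rewrite /b => /eqP; rewrite sqrf_eq0 frobenius_norm_eq0 => /eqP B0.
  by rewrite /c B0 mulmx0 linear0 expr0n mulr_ge0 // sqr_ge0.
have {}b0 : 0 < b by rewrite lt_def b0 sqr_ge0.
have := sqr_ge0 (frobenius_norm (b *: A - c *: B)).
rewrite frobenius_norm_sqr [(_ - _)^T]linearB /= ![(_ *: _)^T]linearZ /=.
rewrite mulmxBl !mulmxBr -!scalemxAl -!scalemxAr !linearB /= !linearZ /= cE -/c.
rewrite -!frobenius_norm_sqr -/a -/b.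
rewrite [X in 0 <= X](_ : _ = b * (a * b - c ^+ 2)); last by rewrite /GRing.scale /=; ring.
by rewrite pmulr_rge0 // subr_ge0.
Qed.

Lemma frobenius_norm_sqr_col m n (A : 'M[R]_(m, n)) :
  frobenius_norm A ^+ 2 = \sum_j frobenius_norm (col j A) ^+ 2.
Proof.
rewrite frobenius_norm_sqr; apply: eq_bigr => j _.
rewrite frobenius_norm_sqr [RHS]big_ord1 !mxE.
by apply: eq_bigr => i _; rewrite !mxE.
Qed.

(** The operator bound applies to each column. *)
Lemma frobenius_norm_mul_le m n k (c : R) (A : 'M[R]_(m, n)) (B : 'M[R]_(n, k)) :
  0 <= c -> (forall x : 'cV[R]_n, frobenius_norm (A *m x) <= c * frobenius_norm x) ->
  frobenius_norm (A *m B) <= c * frobenius_norm B.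
Proof.
move=> c0 Ac.
rewrite -(@ler_pXn2r _ 2) ?nnegrE ?mulr_ge0 ?frobenius_norm_ge0 //.
rewrite exprMn !frobenius_norm_sqr_col mulr_sumr; apply: ler_sum => j _.
rewrite -exprMn colE -mulmxA -colE ler_pXn2r ?nnegrE ?mulr_ge0 ?frobenius_norm_ge0 //.
Qed.

Lemma frobenius_norm_mulmx m n k (A : 'M[R]_(m, n)) (B : 'M[R]_(n, k)) :
  frobenius_norm (A *m B) <= frobenius_norm A * frobenius_norm B.
Proof.
apply: frobenius_norm_mul_le => [|x]; first exact: frobenius_norm_ge0.
rewrite -(@ler_pXn2r _ 2) ?nnegrE ?mulr_ge0 ?frobenius_norm_ge0 //.
rewrite exprMn -(frobenius_norm_tr A) -(frobenius_norm_tr (A *m x)).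
rewrite [X in _ <= X * _]frobenius_norm_sqr_col frobenius_norm_sqr_col mulr_suml.
apply: ler_sum => i _; rewrite -tr_row row_mul -exprMn -tr_row frobenius_norm_tr.
rewrite ler_pXn2r ?nnegrE ?mulr_ge0 ?frobenius_norm_ge0 //.
have := frobenius_CauchySchwarz (row i A)^T x; rewrite trmxK.
apply: le_trans; rewrite /frobenius_norm !big_ord1 sqrtr_sqr.
by rewrite /mxtrace big_ord1.
Qed.

(** The supremum defining the spectral norm is finite because the Frobenius norm
    bounds it; otherwise [sup] would carry no information. *)
Lemma mulmx_spectral_norm m n (A : 'M[R]_(m, n)) (x : 'cV[R]_n) :
  frobenius_norm (A *m x) <= spectral_norm A * frobenius_norm x.
Proof.
have [->|x0] := eqVneq x 0.
  by rewrite mulmx0 !frobenius_norm0 mulr0.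
have nx0 : 0 < frobenius_norm x by rewrite lt_def frobenius_norm_eq0 x0 frobenius_norm_ge0.
rewrite -ler_pdivrMr // mulrC -{1}[(frobenius_norm x)^-1]ger0_norm;
  last by rewrite invr_ge0 frobenius_norm_ge0.
rewrite -frobenius_normZ scalemxAr /spectral_norm; apply: ub_le_sup.
  exists (frobenius_norm A) => _ [y /= y1 <-].
  apply: le_trans (frobenius_norm_mulmx _ _) _.
  by rewrite ler_piMr ?frobenius_norm_ge0.
exists ((frobenius_norm x)^-1 *: x) => //=.
by rewrite frobenius_normZ ger0_norm ?invr_ge0 ?frobenius_norm_ge0 // mulVf ?gt_eqF.
Qed.

End Norms.

(** * Local expansion of the log-likelihood *)

Section LogDet.
Context (R : realType).

(** Mean value theorem: the derivative of the left-hand side is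
    [y ^ 2 / (1 + y)], which is at most [2 x ^ 2] between [0] and [x]. *)
Lemma ln1Dx_taylor2 (x : R) : `|x| <= 1 / 2 ->
  `|ln (1 + x) - x + x ^+ 2 / 2| <= 2 * `|x| ^+ 3.
Proof.
move=> x2; have /andP[xl xr] : - (1/2) <= x <= 1 / 2 by rewrite -ler_norml.
pose f y : R := ln (1 + y) - y + y ^+ 2 / 2.
pose df y : R := y ^+ 2 / (1 + y).
have fd (y : R) : - (1/2) <= y -> is_derive y 1 f (df y).
  move=> yl; have y1 : 0 < 1 + y by lra.
  rewrite /f; have -> : df y = (1 + y)^-1 *: 1 - 1 + y.
    by rewrite /df /GRing.scale /=; field; by rewrite gt_eqF.
  have H : is_derive y 1 (fun z : R => ln (1 + z)) ((1 + y)^-1 *: 1).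
    apply: (@is_derive1_comp _ (@ln R) (fun z => 1 + z)).
      exact: is_derive1_ln.
    by rewrite -[X in is_derive _ _ _ X]add0r; exact: is_deriveD.
  rewrite (_ : (fun z => _) = (fun z => ln (1 + z)) - id + 2^-1 *: (id ^+ 2)); last first.
    by apply/funext => z; rewrite !fctE /GRing.scale /= [_ / 2]mulrC.
  have := is_deriveD (is_deriveB H (is_derive_id y (1 : R)))
    (is_deriveZ (2^-1 : R) (is_deriveX 2 (is_derive_id y (1 : R)))).
  move=> /is_derive_eq; apply; rewrite expr1 /GRing.scale /=; field; by rewrite gt_eqF.
have f0 : f 0 = 0 by rewrite /f addr0 ln1 subrr expr0n mul0r addr0.
have bnd (c : R) : `|c| <= `|x| -> `|df c| <= 2 * `|x| ^+ 2.
  move=> cx; have /andP[cl cr] : - (1/2) <= c <= 1 / 2.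
    by rewrite -ler_norml; exact: le_trans x2.
  rewrite /df normrM normfV [`|1 + c|]gtr0_norm; last by lra.
  rewrite ler_pdivrMr; last by lra.
  rewrite normrX; have : `|c| ^+ 2 <= `|x| ^+ 2.
    by rewrite ler_pXn2r ?nnegrE.
  have := sqr_ge0 `|x|; nra.
suff : `|f x - f 0| <= 2 * `|x| ^+ 2 * `|x| by rewrite f0 subr0 -mulrA -exprSr.
have fd' (u v : R) : - (1/2) <= u ->
    forall z, z \in `]u, v[ -> is_derive z 1 f (df z).
  by move=> u2 z; rewrite in_itv /= => /andP[uz _]; apply: fd; lra.
have fc (u v : R) : - (1/2) <= u -> {within `[u, v], continuous f}.
  move=> u2; apply: derivable_within_continuous => z; rewrite in_itv /= => /andP[uz _].
  by apply: ex_derive; apply: fd; lra.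
have [x0|/ltW x0] := leP 0 x.
  have [||c] := @MVT_segment _ f df 0 x x0; [apply: fd'; lra|apply: fc; lra|].
  rewrite in_itv /= => /andP[c0 cx] ->; rewrite subr0 normrM ler_wpM2r //.
  by apply: bnd; rewrite !ger0_norm.
have [||c] := @MVT_segment _ f df x 0 x0; [exact: fd'|exact: fc|].
rewrite in_itv /= => /andP[c0 cx]; rewrite distrC => ->.
rewrite sub0r normrM normrN ler_wpM2r //.
by apply: bnd; rewrite !ler0_norm ?lerN2.
Qed.

Lemma ln_prod (I : finType) (F : I -> R) : (forall i, 0 < F i) ->
  ln (\prod_i F i) = \sum_i ln (F i).
Proof.
move=> F0; suff [] : 0 < \prod_i F i /\ ln (\prod_i F i) = \sum_i ln (F i) by [].
apply: (big_rec2 (fun x y : R => 0 < x /\ ln x = y)) => [|i x y _ [x0 <-]].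
  by rewrite ln1.
by split; [exact: mulr_gt0|rewrite lnM ?posrE].
Qed.

Lemma frobenius_norm_sqr_sym p (A : 'M[R]_p) : A^T = A ->
  frobenius_norm A ^+ 2 = \tr (A *m A).
Proof. by move=> AT; rewrite frobenius_norm_sqr AT. Qed.

(** Expanding the product leaves [2 tr (F N N) + tr (F N F N)]; both traces are
    Frobenius inner products, of [N] with [F N] and of [(F N)^T] with [F N]. *)
Lemma trace_sandwich_perturb p (N F : 'M[R]_p) (e : R) : N^T = N -> 0 <= e ->
  (forall x : 'cV[R]_p, frobenius_norm (F *m x) <= e * frobenius_norm x) ->
  `|\tr ((1%:M + F) *m N *m (1%:M + F) *m N) - frobenius_norm N ^+ 2|
    <= (2 * e + e ^+ 2) * frobenius_norm N ^+ 2.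
Proof.
move=> NT e0 Fe; set f := frobenius_norm N.
have f0 : 0 <= f by exact: frobenius_norm_ge0.
have FN : frobenius_norm (F *m N) <= e * f by exact: frobenius_norm_mul_le.
have T1 : `|\tr (F *m N *m N)| <= e * f ^+ 2.
  rewrite mxtrace_mulC -{1}NT; apply: le_trans (frobenius_CauchySchwarz _ _) _.
  by rewrite expr2 mulrCA ler_wpM2l.
have T2 : `|\tr (F *m N *m (F *m N))| <= e ^+ 2 * f ^+ 2.
  rewrite -{1}[F *m N]trmxK; apply: le_trans (frobenius_CauchySchwarz _ _) _.
  rewrite frobenius_norm_tr -exprMn expr2.
  by apply: ler_pM => //; exact: frobenius_norm_ge0.
rewrite (_ : \tr _ - _ = \tr (F *m N *m N) *+ 2 + \tr (F *m N *m (F *m N))).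
  apply: le_trans (ler_normD _ _) _; rewrite mulrDl lerD // normrMn -mulrA mulr_natl.
  exact: ler_wMn2r.
rewrite (frobenius_norm_sqr_sym NT) !mulmxDl !mulmxDr !mulmxDl !mul1mx !mulmx1.
rewrite !linearD /= -!mulmxA.
rewrite (mxtrace_mulC N (F *m N)) -!mulmxA mulr2n; lra.
Qed.

(** Second order expansion along the line through [Omega] with direction [Phi].
    The remainder is the sum of the cubes of [h d_i], bounded by the largest one
    times the sum of the squares; both are controlled by [Q], the sum of the
    squared eigenvalues, so no bound on the dimension enters. *)
Lemma loglik_shift n p (S Omega Phi : 'M[R]_p) (h : R) :
  posdefmx Omega -> Phi^T = Phi ->
  let Sigma := invmx Omega in
  let Q := \tr (Sigma *m Phi *m Sigma *m Phi) in
  0 <= Q /\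
  (`|h| * Num.sqrt Q <= 1 / 2 ->
  `|loglik n S (Omega + h *: Phi) - loglik n S Omega
    - n%:R / 2 * (h * \tr ((Sigma - S) *m Phi) - h ^+ 2 / 2 * Q)|
    <= n%:R * (`|h| * Num.sqrt Q) ^+ 3).
Proof.
move=> Opos PhiT Sigma Q.
have Ou := posdefmx_unit Opos.
have Spsd : possemidefmx Sigma.
  have [OT Op] := Opos; split; first by rewrite trmx_inv OT.
  move=> x; have := (posdefmx_psd Opos).2 (Sigma *m x).
  by rewrite /quad_form trmx_mul trmx_inv OT !mulmxA mulmxKV // mulmxKV.
have [[rT _] rr] := mxsqrtP Spsd; set r := mxsqrt Sigma in rT rr.
pose M := r *m Phi *m r.
have MT : M^T = M by rewrite /M !trmx_mul rT PhiT mulmxA.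
have [U [d [Uu Meq]]] := symmetric_diagonalization MT.
have ru : r \in unitmx.
  have : Sigma \in unitmx by rewrite unitmx_inv.
  by rewrite -rr unitmx_mul => /andP[].
have QE : Q = \sum_i d 0 i ^+ 2.
  rewrite -(trace_sqr_diagonalized Uu Meq) /Q -rr /M.
  by rewrite -!mulmxA mxtrace_mulC -!mulmxA.
have Q0 : 0 <= Q by rewrite QE; apply: sumr_ge0 => *; exact: sqr_ge0.
split=> // hQ.
have dh i : `|h * d 0 i| <= `|h| * Num.sqrt Q.
  rewrite normrM ler_wpM2l // -sqrtr_sqr ler_wsqrtr // QE (bigD1 i) //= lerDl.
  by apply: sumr_ge0 => *; exact: sqr_ge0.
have d1 i : 0 < 1 + h * d 0 i.
  have : `|h * d 0 i| <= 1 / 2 by exact: le_trans hQ.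
  by rewrite ler_norml => /andP[]; lra.
have detO : \det Omega != 0 by rewrite -unitfE -unitmxE.
have detE : \det (Omega + h *: Phi) = \det Omega * \prod_i (1 + h * d 0 i).
  rewrite -(det_1DZ_diagonalized Uu Meq).
  have -> : Omega + h *: Phi = Omega *m r *m (1%:M + h *: M) *m invmx r.
    rewrite mulmxDr mulmxDl mulmx1 mulmxK // -!scalemxAr -scalemxAl.
    by rewrite /M !mulmxA mulmxK // -(mulmxA Omega) rr mulmxV // mul1mx.
  rewrite !det_mulmx det_inv mulrAC mulfK //.
  by rewrite -unitfE -unitmxE.
have detOpos : 0 < \det Omega.
  rewrite lt_def detO -(mxsqrtP (posdefmx_psd Opos)).2 det_mulmx -expr2.
  exact: sqr_ge0.
set L := \sum_i (ln (1 + h * d 0 i) - h * d 0 i + (h * d 0 i) ^+ 2 / 2).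
have trE : \tr (Sigma *m Phi) = \sum_i d 0 i.
  by rewrite -(trace_diagonalized Uu Meq) /M [RHS]mxtrace_mulC mulmxA rr.
have LE : loglik n S (Omega + h *: Phi) - loglik n S Omega
    - n%:R / 2 * (h * \tr ((Sigma - S) *m Phi) - h ^+ 2 / 2 * Q) = n%:R / 2 * L.
  rewrite /loglik detE lnM ?posrE //; last by apply: prodr_gt0.
  rewrite ln_prod // /L big_split /= sumrB -mulr_sumr -trE.
  under [X in _ = _ * (_ + X)]eq_bigr do rewrite exprMn mulrAC.
  have trD : \tr ((Omega + h *: Phi) *m S) = \tr (Omega *m S) + h * \tr (S *m Phi).
    by rewrite mulmxDl -scalemxAl mxtraceD mxtraceZ (mxtrace_mulC Phi).
  have trB : \tr ((Sigma - S) *m Phi) = \tr (Sigma *m Phi) - \tr (S *m Phi).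
    by rewrite mulmxBl raddfB.
  rewrite -mulr_sumr -QE trD trB; ring.
rewrite LE normrM ger0_norm ?divr_ge0 // mulrAC -mulrA ler_wpM2l //.
rewrite ler_pdivrMr //; apply: le_trans (ler_norm_sum _ _ _) _.
apply: (@le_trans _ _ (\sum_i 2 * (`|h| * Num.sqrt Q) * (h ^+ 2 * d 0 i ^+ 2))).
  apply: ler_sum => i _; apply: le_trans (ln1Dx_taylor2 (le_trans (dh i) hQ)) _.
  rewrite exprS mulrA -normrX -exprMn [`|_ ^+ 2|]ger0_norm ?sqr_ge0 //.
  rewrite ler_wpM2r ?sqr_ge0 //.
  by rewrite ler_wpM2l.
rewrite -mulr_sumr -mulr_sumr -QE -[X in _ * (_ * X)](sqr_sqrtr Q0).
rewrite -[h ^+ 2](real_normK (num_real h)) le_eqVlt.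
by apply/orP; left; apply/eqP; ring.
Qed.
End LogDet.

Section LocalExpansion.
Context (R : realType) (p : nat) (SigmaStar Phi : 'M[R]_p).
Hypotheses (Spos : posdefmx SigmaStar) (PhiT : Phi^T = Phi).
Let r := mxsqrt SigmaStar.
Let s := frobenius_norm (r *m Phi *m r).

Lemma mxsqrt_posdef : [/\ r^T = r, r *m r = SigmaStar & r \in unitmx].
Proof.
have [[rT _] rr] := mxsqrtP (posdefmx_psd Spos); split => //.
by have := posdefmx_unit Spos; rewrite -{1}rr unitmx_mul => /andP[].
Qed.

(** Makes every division by the scale meaningful. *)
Lemma scale_gt0 : Phi != 0 -> 0 < s.
Proof.
have [_ _ ru] := mxsqrt_posdef.
rewrite lt_def frobenius_norm_ge0 andbT frobenius_norm_eq0; apply: contra => /eqP e.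
by rewrite -(mulKmx ru Phi) -(mulmxK ru (r *m Phi)) e mul0mx mulmx0.
Qed.

(** Writing [Sigma - SigmaStar = r F r], the quantity becomes
    [tr ((1 + F) N (1 + F) N)] with [N = r Phi r], and [F] has operator norm at most
    [C * delta] since the inverse of [r] has squared operator norm at most [C]. The
    bound is relative to [s ^ 2], so it is uniform in the dimension. *)
Lemma trace_quadratic_perturb (Sigma : 'M[R]_p) (C delta : R) :
  0 <= C -> 0 <= delta ->
  spectral_norm (invmx SigmaStar) <= C -> spectral_norm (Sigma - SigmaStar) <= delta ->
  `|\tr (Sigma *m Phi *m Sigma *m Phi) - s ^+ 2|
    <= (2 * (C * delta) + (C * delta) ^+ 2) * s ^+ 2.
Proof.
move=> C0 d0 HC Hd; have [rT rr ru] := mxsqrt_posdef.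
set v := invmx r; have vT : v^T = v by rewrite trmx_inv rT.
have vv : v *m v = invmx SigmaStar.
  apply: (can_inj (mulKmx (posdefmx_unit Spos))).
  by rewrite mulmxV ?posdefmx_unit // -rr -mulmxA mulKVmx // mulmxV.
have vb (x : 'cV[R]_p) : frobenius_norm (v *m x) <= Num.sqrt C * frobenius_norm x.
  rewrite -(@ler_pXn2r _ 2) ?nnegrE ?mulr_ge0 ?frobenius_norm_ge0 ?sqrtr_ge0 //.
  rewrite exprMn (sqr_sqrtr C0) frobenius_norm_sqr trmx_mul vT -mulmxA (mulmxA v v x) vv.
  apply: le_trans (ler_norm _) _; apply: le_trans (frobenius_CauchySchwarz _ _) _.
  rewrite expr2 mulrCA ler_wpM2l ?frobenius_norm_ge0 //.
  apply: le_trans (mulmx_spectral_norm _ _) _.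
  by rewrite ler_wpM2r ?frobenius_norm_ge0.
set F := v *m (Sigma - SigmaStar) *m v.
have Fb (x : 'cV[R]_p) : frobenius_norm (F *m x) <= C * delta * frobenius_norm x.
  rewrite /F -!mulmxA; apply: le_trans (vb _) _.
  rewrite -{2}(sqr_sqrtr C0) expr2 -!mulrA ler_wpM2l ?sqrtr_ge0 //.
  apply: le_trans (mulmx_spectral_norm _ _) _.
  apply: le_trans (ler_wpM2r (frobenius_norm_ge0 _) Hd) _.
  by rewrite mulrCA ler_wpM2l.
have NT : (r *m Phi *m r)^T = r *m Phi *m r by rewrite !trmx_mul rT PhiT mulmxA.
have := trace_sandwich_perturb NT (mulr_ge0 C0 d0) Fb.
suff -> : \tr (Sigma *m Phi *m Sigma *m Phi) =
  \tr ((1%:M + F) *m (r *m Phi *m r) *m (1%:M + F) *m (r *m Phi *m r)) by [].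
have SE : Sigma = r *m (1%:M + F) *m r.
  rewrite mulmxDr mulmx1 mulmxDl rr /F !mulmxA mulmxV // mul1mx mulmxKV //.
  by rewrite addrC subrK.
by rewrite SE -!mulmxA mxtrace_mulC -!mulmxA.
Qed.

(** The choice of [h] makes the linear term equal to [t] times the standardized
    statistic and the quadratic term equal to [t ^ 2 / 2] when
    [tr (Sigma Phi Sigma Phi)] is exactly [s ^ 2]. The last hypothesis keeps
    every [h d_i] in [[-1/2, 1/2]], using [kappa <= 1]. *)
Lemma loglik_expansion n (S Omega : 'M[R]_p) (t kappa : R) :
  posdefmx Omega -> Phi != 0 -> (0 < n)%N ->
  let Sigma := invmx Omega in
  `|\tr (Sigma *m Phi *m Sigma *m Phi) - s ^+ 2| <= kappa * s ^+ 2 ->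
  kappa <= 1 -> 4 * `|t| <= Num.sqrt n%:R ->
  `|loglik n S (Omega + (Num.sqrt 2 * t / (Num.sqrt n%:R * s)) *: Phi)
    - loglik n S Omega
    - (t * (Num.sqrt n%:R * \tr ((Sigma - S) *m Phi) / (Num.sqrt 2 * s))
       - t ^+ 2 / 2)| <= t ^+ 2 / 2 * kappa + 8 * `|t| ^+ 3 / Num.sqrt n%:R.
Proof.
move=> Opos Phi0 n0 Sigma Qs k1 tn.
have s0 := scale_gt0 Phi0.
set h := Num.sqrt 2 * t / _.
have [Q0 +] := loglik_shift n S h Opos PhiT.
rewrite -/Sigma; set Q := \tr (Sigma *m _ *m _ *m _) in Q0 Qs *.
set rn := Num.sqrt n%:R in h tn *.
have rn0 : 0 < rn by rewrite sqrtr_gt0 ltr0n.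
have rnn : n%:R = rn ^+ 2 by rewrite sqr_sqrtr.
have q0 : 0 < Num.sqrt 2 :> R by rewrite sqrtr_gt0.
have q2 : Num.sqrt 2 ^+ 2 = 2 :> R by rewrite sqr_sqrtr.
have hQ : `|h| * Num.sqrt Q <= 2 * `|t| / rn.
  have Q2 : Q <= 2 * s ^+ 2.
    have : kappa * s ^+ 2 <= s ^+ 2 by rewrite ler_piMl ?sqr_ge0.
    by move: Qs; rewrite ler_norml => /andP[]; lra.
  have sQ : Num.sqrt Q <= Num.sqrt 2 * s.
    by rewrite -[X in _ * X](ger0_norm (ltW s0)) -sqrtr_sqr -sqrtrM // ler_sqrt // mulr_ge0 // sqr_ge0.
  apply: le_trans (ler_wpM2l (normr_ge0 h) sQ) _.
  rewrite /h normrM normfV normrM (gtr0_norm q0) [`|rn * s|]gtr0_norm ?mulr_gt0 //.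
  rewrite le_eqVlt; apply/orP; left; apply/eqP.
  by rewrite -[in RHS]q2; field; rewrite !gt_eqF.
have hQ2 : `|h| * Num.sqrt Q <= 1 / 2.
  apply: le_trans hQ _; rewrite ler_pdivrMr //; lra.
move=> /(_ hQ2); set D := loglik n S _ - loglik n S _; set tau := \tr _.
have -> : D - (t * (rn * tau / (Num.sqrt 2 * s)) - t ^+ 2 / 2) =
  (D - n%:R / 2 * (h * tau - h ^+ 2 / 2 * Q)) + t ^+ 2 / 2 * ((s ^+ 2 - Q) / s ^+ 2).
  have hE : h ^+ 2 = 2 * t ^+ 2 / (rn ^+ 2 * s ^+ 2).
    by rewrite /h expr_div_n !exprMn q2.
  have hE1 : n%:R / 2 * h = t * rn / (Num.sqrt 2 * s).
    by rewrite rnn /h -[in X in _ / X]q2; field; rewrite !gt_eqF.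
  rewrite mulrBr [n%:R / 2 * (h * tau)]mulrA hE1 hE rnn; field; by rewrite !gt_eqF.
move=> HD; apply: le_trans (ler_normD _ _) _; rewrite addrC; apply: lerD.
  rewrite normrM ger0_norm ?divr_ge0 ?sqr_ge0 // ler_wpM2l ?divr_ge0 ?sqr_ge0 //.
  rewrite normrM normfV [`|s ^+ 2|]ger0_norm ?sqr_ge0 // ler_pdivrMr ?exprn_gt0 //.
  by rewrite distrC.
apply: le_trans HD _.
apply: (@le_trans _ _ (n%:R * (2 * `|t| / rn) ^+ 3)).
  rewrite ler_wpM2l // lerXn2r ?nnegrE ?mulr_ge0 ?sqrtr_ge0 //.
  by rewrite invr_ge0 ltW.
rewrite rnn le_eqVlt; apply/orP; left; apply/eqP.
by field; rewrite gt_eqF.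
Qed.

End LocalExpansion.

(** * Functions approximated by exponentials *)

Section ExpClosure.
Context (R : realType).
Implicit Types (f g : R -> R) (x y : R).

(** The limits allow an error that grows exponentially, at a rate which may
    change from one limit to the next: the Taylor polynomials of [cos (u x)]
    converge only against a rate of order [|u|], and the frequencies that occur
    below are not bounded. *)
Inductive exp_closure : (R -> R) -> Prop :=
| exp_closure_exp t : exp_closure (fun x => expR (t * x))
| exp_closure_add f g : exp_closure f -> exp_closure g ->
    exp_closure (fun x => f x + g x)
| exp_closure_scale c f : exp_closure f -> exp_closure (fun x => c * f x)
| exp_closure_limit (a : nat) f (g : nat -> R -> R) :
    (forall k, exp_closure (g k)) ->
    (forall k x, `|f x - g k x| <= k.+1%:R^-1 * expR (a%:R * `|x|)) ->
    exp_closure f.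

Lemma exp_closure_approx (a : nat) f :
  (forall eps, 0 < eps -> exists g, exp_closure g /\
     forall x, `|f x - g x| <= eps * expR (a%:R * `|x|)) -> exp_closure f.
Proof.
move=> H; have /choice[g Hg] : forall k : nat, exists g, exp_closure g /\
    forall x, `|f x - g x| <= k.+1%:R^-1 * expR (a%:R * `|x|).
  by move=> k; apply: H; rewrite invr_gt0.
by apply: (@exp_closure_limit a f g) => k; have [] := Hg k.
Qed.

(** From [exp y >= 1 + y] and [exp (-y) >= 1 - y] alone. *)
Lemma expR_taylor1 y : `|expR y - 1 - y| <= y ^+ 2 * expR `|y|.
Proof.
have e1 := expR_ge1Dx y; have e2 := expR_ge1Dx (- y).
have e3 : expR y * expR (- y) = 1 := expRxMexpNx_1 y.
have e0 := expR_gt0 y.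
have ub : expR y - 1 - y <= y * (expR y - 1) by nra.
rewrite ger0_norm; last by lra.
apply: le_trans ub _; have [y0|y0] := leP 0 y.
  rewrite ger0_norm // expr2 -mulrA ler_wpM2l //; nra.
have e4 : 1 <= expR `|y| by apply: le_trans (expR_ge1Dx _); rewrite lerDl.
have := sqr_ge0 y; nra.
Qed.

Lemma sqr_le_expR y : y ^+ 2 <= 2 * expR `|y|.
Proof.
have := @expR_ge1Dxn R `|y| 1 (normr_ge0 y).
rewrite real_normK ?num_real // (_ : 2`!%:R = 2) //; lra.
Qed.

(** On exponentials, [x exp (t x)] is the limit of difference quotients in [t];
    the other constructors are stable because [|x| <= exp |x|] only raises the
    rate by one. *)
Lemma exp_closure_mulx f : exp_closure f -> exp_closure (fun x => x * f x).
Proof.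
elim=> {f} [t|f g _ IHf _ IHg|c f _ IH|a f g _ IH fg].
- pose a := (Num.truncn `|t|).+3.
  (* The rate must exceed [|t| + 2]: one unit pays for [x ^ 2], one for the Taylor
     remainder with [h <= 1]. *)
  apply: (@exp_closure_approx a) => eps eps0.
  pose h := Num.min 1 (eps / 2); have h0 : 0 < h by rewrite lt_min ltr01 divr_gt0.
  have h1 : h <= 1 by rewrite ge_min lexx.
  have h2 : 2 * h <= eps.
    by rewrite mulrC -ler_pdivlMr // ge_min lexx orbT.
  exists (fun x => h^-1 * expR ((t + h) * x) + (- h^-1) * expR (t * x)); split.
    by apply: exp_closure_add; apply: exp_closure_scale; exact: exp_closure_exp.
  move=> x; rewrite mulrDl expRD.
  rewrite (_ : _ - _ = - (expR (t * x) * (h^-1 * (expR (h * x) - 1 - h * x)))); last first.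
    by field; rewrite gt_eqF.
  rewrite normrN normrM (gtr0_norm (expR_gt0 _)).
  rewrite normrM [`|h^-1|]gtr0_norm ?invr_gt0 //.
  have H1 := expR_taylor1 (h * x).
  have H2 : h^-1 * `|expR (h * x) - 1 - h * x| <= 2 * h * expR (2 * `|x|).
    rewrite ler_pdivrMl //; apply: le_trans H1 _.
    rewrite (_ : 2 * `|x| = `|x| + `|x|); last by ring.
    rewrite expRD [leRHS](_ : _ = h ^+ 2 * (2 * expR `|x|) * expR `|x|); last by ring.
    rewrite exprMn; apply: ler_pM; rewrite -?exprMn ?sqr_ge0 ?expR_ge0 //.
      by rewrite exprMn ler_wpM2l ?sqr_ge0 // sqr_le_expR.
    by rewrite ler_expR normrM (gtr0_norm h0) ler_piMl.
  apply: le_trans (ler_wpM2l (expR_ge0 _) H2) _.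
  rewrite mulrCA; apply: ler_pM; rewrite ?mulr_ge0 ?expR_ge0 ?(ltW h0) //.
  rewrite -expRD ler_expR.
  apply: (@le_trans _ _ (`|t| * `|x| + 2 * `|x|)).
    by rewrite lerD2r -normrM ler_norm.
  rewrite -mulrDl ler_wpM2r // /a.
  have := truncnS_gt `|t|; rewrite -[_.+3%:R]natr1 -[_.+2%:R]natr1; lra.
- rewrite (_ : (fun x => _) = (fun x => x * f x + x * g x)).
    exact: exp_closure_add.
  by apply/funext => x; rewrite mulrDr.
- rewrite (_ : (fun x => _) = (fun x => c * (x * f x))).
    exact: exp_closure_scale.
  by apply/funext => x; rewrite mulrCA.
- apply: (@exp_closure_limit a.+1 _ (fun k x => x * g k x)) => // k x.
  rewrite -mulrBr normrM mulrC -(natr1 a) mulrDl mul1r expRD mulrA.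
  apply: ler_pM => //; apply: le_trans (expR_ge1Dx _); lra.
Qed.

Lemma exp_closure_cst c : exp_closure (fun=> c).
Proof.
rewrite (_ : (fun=> c) = (fun x => c * expR (0 * x))).
  exact/exp_closure_scale/exp_closure_exp.
by apply/funext => x; rewrite mul0r expR0 mulr1.
Qed.

Lemma exp_closure_affineX u c k : exp_closure (fun x => (u * x + c) ^+ k).
Proof.
elim: k => [|k IH]; first exact: exp_closure_cst.
rewrite (_ : (fun x => _) =
  (fun x => u * (x * (u * x + c) ^+ k) + c * (u * x + c) ^+ k)).
  by apply: exp_closure_add; apply: exp_closure_scale => //; exact: exp_closure_mulx.
by apply/funext => x; rewrite exprS mulrDl mulrA.
Qed.

Lemma exp_closure_sum (I : Type) (s : seq I) (F : I -> R -> R) :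
  (forall i, exp_closure (F i)) -> exp_closure (fun x => \sum_(i <- s) F i x).
Proof.
move=> HF; elim: s => [|i s IH].
  rewrite (_ : (fun x => _) = (fun=> 0)); first exact: exp_closure_cst.
  by apply/funext => x; rewrite big_nil.
rewrite (_ : (fun x => _) = (fun x => F i x + \sum_(j <- s) F j x)).
  exact: exp_closure_add.
by apply/funext => x; rewrite big_cons.
Qed.

Lemma exp_series_le y n : 0 <= y -> \sum_(0 <= k < n) exp_coeff y k <= expR y.
Proof.
move=> y0; rewrite /expR; apply: nondecreasing_cvgn_le; last exact: is_cvg_series_exp_coeff.
by apply: nondecreasing_series => k _ _; exact: exp_coeff_ge0.
Qed.

(** The tail of the series is dominated by that of [exp |y|], and [2 ^ (k - m) >= 1]
    for [k >= m] trades the tail for the whole series at [2 |y|]. The point is the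
    uniformity in [y]: the factor [2 ^ (- m)] does not depend on it. *)
Lemma cos_taylor y m :
  `|cos y - \sum_(0 <= k < m) cos_coeff y k| <= 2^-1 ^+ m * expR (2 * `|y|).
Proof.
have cvg1 : series (cos_coeff y) n - series (cos_coeff y) m @[n --> \oo]
    --> cos y - series (cos_coeff y) m.
  apply: cvgB; last exact: cvg_cst.
  by rewrite cos.unlock; exact: is_cvg_series_cos_coeff.
have /cvg_norm cvg2 := cvg1.
rewrite -[X in _ - X]/(series (cos_coeff y) m).
rewrite -(cvg_lim (@Rhausdorff R) cvg2); apply: limr_le.
  by apply/cvg_ex; eexists; exact: cvg2.
near=> n.
have mn : (m <= n)%N by near: n; exact: nbhs_infty_ge.
rewrite sub_series_geq //; apply: le_trans (ler_norm_sum _ _ _) _.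
apply: (@le_trans _ _ (\sum_(m <= k < n) 2^-1 ^+ m * exp_coeff (2 * `|y|) k)).
  apply: ler_sum_nat => k /andP[mk _].
  apply: (@le_trans _ _ (`|y| ^+ k / k`!%:R)).
    rewrite /cos_coeff /= !normrM normfV !normr_nat !normrX normrN normr1 expr1n mulr1.
    by case: odd; rewrite ?mul0r ?mul1r // divr_ge0 // exprn_ge0.
  rewrite /exp_coeff /= exprMn !mulrA ler_wpM2r ?invr_ge0 // ler_peMl ?exprn_ge0 //.
  rewrite -(subnK mk) exprD mulrCA -exprMn mulVf // expr1n mulr1.
  by apply: exprn_ege1; rewrite ler1n.
rewrite -mulr_sumr ler_wpM2l ?exprn_ge0 ?invr_ge0 //.
apply: le_trans (@exp_series_le (2 * `|y|) n _); last by rewrite mulr_ge0.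
rewrite [leRHS](@big_cat_nat _ _ _ m) //= lerDr; apply: sumr_ge0 => k _.
exact: exp_coeff_ge0.
Unshelve. all: by end_near.
Qed.

Lemma exp_closure_cos u c : exp_closure (fun x => cos (u * x + c)).
Proof.
pose a := (Num.truncn (2 * `|u|)).+1.
apply: (@exp_closure_approx a) => eps eps0.
have K0 : 0 < expR (2 * `|c|) by exact: expR_gt0.
have [m Hm] : exists m, 2^-1 ^+ m * expR (2 * `|c|) <= eps.
  have : (fun m => 2^-1 ^+ m : R) @ \oo --> 0.
    by apply: cvg_expr; rewrite ger0_norm ?invr_ge0 // invf_lt1 // ltr1n.
  move/cvgr_le => /(_ (eps / expR (2 * `|c|)) (divr_gt0 eps0 K0)) [m _ Hm].
  by exists m; rewrite -ler_pdivlMr //; apply: Hm => /=.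
exists (fun x => \sum_(k <- index_iota 0 m) cos_coeff (u * x + c) k); split.
  apply: exp_closure_sum => k.
  rewrite (_ : (fun x => _) = (fun x => (~~ odd k)%:R * (-1) ^+ k./2 / k`!%:R * (u * x + c) ^+ k)).
    by apply: exp_closure_scale; exact: exp_closure_affineX.
  by apply/funext => x; rewrite cos_coeffE.
move=> x; apply: le_trans (cos_taylor _ _) _.
apply: (@le_trans _ _ (2^-1 ^+ m * expR (2 * `|c|) * expR (2 * `|u| * `|x|))).
  rewrite -mulrA ler_wpM2l ?exprn_ge0 ?invr_ge0 // -expRD ler_expR -mulrA -mulrDr.
  by rewrite ler_wpM2l // addrC -normrM ler_normD.
apply: ler_pM; rewrite ?mulr_ge0 ?exprn_ge0 ?invr_ge0 ?expR_ge0 //.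
by rewrite ler_expR ler_wpM2r // ltW // truncnS_gt.
Qed.

(** Linear combinations of cosines with arbitrary frequencies and phases: bounded
    functions, closed under products, hence under polynomials. *)
Inductive trig_sum : (R -> R) -> Prop :=
| trig_sum_cos u c : trig_sum (fun x => cos (u * x + c))
| trig_sum_add f g : trig_sum f -> trig_sum g -> trig_sum (fun x => f x + g x)
| trig_sum_scale c f : trig_sum f -> trig_sum (fun x => c * f x).

Lemma trig_sum_closure f : trig_sum f -> exp_closure f.
Proof.
elim=> {f} [u c|f g _ fe _ ge|c f _ fe]; first exact: exp_closure_cos.
  exact: exp_closure_add.
exact: exp_closure_scale.
Qed.

Lemma trig_sum_sin u c : trig_sum (fun x => sin (u * x + c)).
Proof.
rewrite (_ : (fun x => _) = (fun x => cos (u * x + (c - pi / 2)))).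
  exact: trig_sum_cos.
by apply/funext => x; rewrite addrA cosBpihalf.
Qed.

Lemma trig_sum_mul f g : trig_sum f -> trig_sum g -> trig_sum (fun x => f x * g x).
Proof.
move=> tf tg; elim: tf => {f} [u c|f1 f2 _ IH1 _ IH2|c f _ IH]; last first.
- rewrite (_ : (fun x => _) = (fun x => c * (f x * g x))).
    exact: trig_sum_scale.
  by apply/funext => x; rewrite mulrA.
- rewrite (_ : (fun x => _) = (fun x => f1 x * g x + f2 x * g x)).
    exact: trig_sum_add.
  by apply/funext => x; rewrite mulrDl.
elim: tg => {g} [v e|f1 f2 _ IH1 _ IH2|e f _ IH].
- rewrite (_ : (fun x => _) =
    (fun x => 2^-1 * (cos ((u + v) * x + (c + e)) + cos ((u - v) * x + (c - e))))).
    by apply: trig_sum_scale; apply: trig_sum_add; exact: trig_sum_cos.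
  apply/funext => x.
  rewrite (_ : (u + v) * x + _ = u * x + c + (v * x + e)); last by ring.
  rewrite (_ : (u - v) * x + _ = u * x + c - (v * x + e)); last by ring.
  by rewrite (cosD (u * x + c)) (cosB (u * x + c)); field.
- rewrite (_ : (fun x => _) = (fun x => cos (u * x + c) * f1 x + cos (u * x + c) * f2 x)).
    exact: trig_sum_add.
  by apply/funext => x; rewrite mulrDr.
- rewrite (_ : (fun x => _) = (fun x => e * (cos (u * x + c) * f x))).
    exact: trig_sum_scale.
  by apply/funext => x; rewrite mulrCA.
Qed.

(** The odd cubic with fixed points [-1], [0], [1] whose derivative vanishes at
    [-1] and [1]: on [[-1, 1]] its iterates tend to the sign function. *)
Definition sharpen (s : R) : R := (3 * s - s ^+ 3) / 2.

Lemma trig_sum_sharpen k f : trig_sum f -> trig_sum (fun x => iter k sharpen (f x)).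
Proof.
move=> tf; elim: k => [//|k IH].
set g := fun x => _ in IH.
rewrite (_ : (fun x => _) = (fun x => 3 / 2 * g x + (- 2^-1) * (g x * (g x * g x)))).
  apply: trig_sum_add; apply: trig_sum_scale => //.
  by apply: trig_sum_mul => //; exact: trig_sum_mul.
by apply/funext => x /=; rewrite /sharpen /g; field.
Qed.

Lemma sharpen_itv s : -1 <= s <= 1 -> -1 <= sharpen s <= 1.
Proof.
move=> /andP[s1 s2]; rewrite /sharpen.
have h1 : 0 <= (1 - s) ^+ 2 * (2 + s) by rewrite mulr_ge0 ?sqr_ge0 //; lra.
have h2 : 0 <= (1 + s) ^+ 2 * (2 - s) by rewrite mulr_ge0 ?sqr_ge0 //; lra.
by apply/andP; split; nra.
Qed.

Lemma iter_sharpen_itv k s : -1 <= s <= 1 -> -1 <= iter k sharpen s <= 1.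
Proof. by move=> s1; elim: k => [//|k IH] /=; exact: sharpen_itv. Qed.

Lemma iter_sharpenN k s : iter k sharpen (- s) = - iter k sharpen s.
Proof.
by elim: k => [//|k /= ->]; rewrite /sharpen; field.
Qed.

(** One step multiplies [1 - u] by [1 - u (1 + u) / 2], which is at most
    [1 - e / 2] as long as [u >= e]. *)
Lemma iter_sharpen_ge k (e s : R) : 0 <= e -> e <= s <= 1 ->
  e <= iter k sharpen s <= 1 /\ 1 - iter k sharpen s <= (1 - e / 2) ^+ k.
Proof.
move=> e0 es; elim: k => [|k [+ IH]] /=.
  by move/andP: es => [es s1]; rewrite es s1 expr0; split => //; lra.
set u := iter k _ _ in IH *; move=> /andP[eu u1].
have h1 : 0 <= u * (1 - u ^+ 2) by rewrite mulr_ge0 ?subr_ge0 ?exprn_ile1 //; lra.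
have h2 : 0 <= (1 - u) ^+ 2 * (2 + u) by rewrite mulr_ge0 ?sqr_ge0 //; lra.
split; first by rewrite /sharpen; apply/andP; split; nra.
rewrite exprS mulrC.
have : (1 - u) * (1 - e / 2) <= (1 - e / 2) ^+ k * (1 - e / 2).
  by rewrite ler_wpM2r //; lra.
apply: le_trans; rewrite /sharpen.
have -> : 1 - (3 * u - u ^+ 3) / 2 = (1 - u) * (1 - u * (1 + u) / 2) by field.
rewrite ler_wpM2l; nra.
Qed.

End ExpClosure.

(** * Moment generating functions determine distribution functions *)

Section Expectation.
Context (R : realType).
Implicit Types (f g : R -> R) (x y : R).

(** One natural number serves as constant and as rate, so that the class is
    visibly closed under sums. *)
Definition exp_growth f :=
  measurable_fun [set: R] f /\
  exists k : nat, forall x, `|f x| <= k%:R * expR (k%:R * `|x|).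

Lemma exp_growth_exp t : exp_growth (fun x => expR (t * x)).
Proof.
split; first by apply: measurableT_comp => //; exact: measurable_funM.
exists (Num.truncn `|t|).+1 => x; rewrite ger0_norm ?expR_ge0 //.
apply: (@le_trans _ _ (expR ((Num.truncn `|t|).+1%:R * `|x|))).
  rewrite ler_expR; apply: le_trans (ler_norm _) _; rewrite normrM ler_wpM2r //.
  by rewrite ltW // truncnS_gt.
by rewrite ler_peMl ?expR_ge0 // ler1n.
Qed.

Lemma exp_growthD f g : exp_growth f -> exp_growth g -> exp_growth (fun x => f x + g x).
Proof.
move=> [mf [k fk]] [mg [l gl]]; split; first exact: measurable_funD.
exists (k + l)%N => x; apply: le_trans (ler_normD _ _) _.
rewrite natrD [leRHS]mulrDl; apply: lerD.
  apply: le_trans (fk x) _; rewrite ler_wpM2l // ler_expR ler_wpM2r //.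
  by rewrite lerDl.
apply: le_trans (gl x) _; rewrite ler_wpM2l // ler_expR ler_wpM2r //.
by rewrite lerDr.
Qed.

Lemma exp_growthZ c f : exp_growth f -> exp_growth (fun x => c * f x).
Proof.
move=> [mf [k fk]]; split; first exact: measurable_funM.
exists ((Num.truncn `|c|).+1 * k)%N => x.
rewrite normrM natrM -[leRHS]mulrA; apply: ler_pM => //.
  by rewrite ltW // truncnS_gt.
apply: le_trans (fk x) _; rewrite ler_wpM2l // ler_expR ler_wpM2r //.
by rewrite ler_peMl // ler1n.
Qed.

Lemma exp_growth_bounded f : measurable_fun [set: R] f ->
  (forall x, `|f x| <= 1) -> exp_growth f.
Proof.
move=> mf f1; split=> //; exists 1%N => x; rewrite !mul1r.
by apply: le_trans (f1 x) _; apply: le_trans (expR_ge1Dx _); rewrite lerDl.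
Qed.

Lemma exp_closure_growth f : exp_closure f -> exp_growth f.
Proof.
elim=> {f} [t|f g _ IHf _ IHg|c f _ IH|a f g _ IH fg].
- exact: exp_growth_exp.
- exact: exp_growthD.
- exact: exp_growthZ.
- split.
    apply: (@measurable_realfun.measurable_fun_cvg _ _ _ setT g) => [k|x _].
      by have [] := IH k.
    apply/cvgrPdist_le => eps eps0.
    have : (fun k : nat => k.+1%:R^-1 * expR (a%:R * `|x|)) @ \oo --> 0.
      rewrite -[X in _ --> X](mul0r (expR (a%:R * `|x|))).
      apply: cvgM; last exact: cvg_cst.
      exact: cvg_harmonic.
    move=> /cvgr_le/(_ _ eps0); apply: filterS => k; exact: le_trans (fg k x).
  have [_ [l gl]] := IH 0%N.
  exists (a + l).+1 => x.
  rewrite -[f x](subrK (g 0%N x)); apply: le_trans (ler_normD _ _) _.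
  have e1 : expR (a%:R * `|x|) <= expR ((a + l).+1%:R * `|x|).
    by rewrite ler_expR ler_wpM2r // ler_nat leqW // leq_addr.
  have e2 : expR (l%:R * `|x|) <= expR ((a + l).+1%:R * `|x|).
    by rewrite ler_expR ler_wpM2r // ler_nat leqW // leq_addl.
  have h1 := fg 0%N x; rewrite invr1 mul1r in h1.
  have h2 := ler_wpM2l (ler0n R l) e2.
  have h3 := gl x.
  have a0 : 0 <= a%:R * expR ((a + l).+1%:R * `|x|) by rewrite mulr_ge0 ?expR_ge0.
  rewrite [leRHS](_ : _ = (1 + a%:R + l%:R) * expR ((a + l).+1%:R * `|x|)).
    by rewrite !mulrDl mul1r; lra.
  by rewrite -natr1 natrD; ring.
Qed.

(** Integration of functions of exponential growth against a probability law on
    the line all of whose exponential moments are finite. Only these properties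
    are used below, which treats the Gaussian law and the random posterior law in
    the same way. *)
Definition mean_functional (E : (R -> R) -> R) :=
  [/\ forall f g, exp_growth f -> exp_growth g ->
        E (fun x => f x + g x) = E f + E g,
      forall c f, exp_growth f -> E (fun x => c * f x) = c * E f,
      forall f g, exp_growth f -> exp_growth g -> (forall x, f x <= g x) -> E f <= E g
    & E (fun=> 1) = 1].

Definition mgf (E : (R -> R) -> R) t := E (fun x => expR (t * x)).

Definition cdf_of (E : (R -> R) -> R) (c : R) := E (fun x => (x <= c)%R%:R).

Definition mgf_close (ts : seq R) (delta : R) (E G : (R -> R) -> R) :=
  forall t, t \in ts -> `|mgf E t - mgf G t| <= delta.

Lemma mgf_close_sub (ts ts' : seq R) (delta delta' : R) E G :
  {subset ts <= ts'} -> delta' <= delta -> mgf_close ts' delta' E G ->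
  mgf_close ts delta E G.
Proof. by move=> sub le close t /sub/close/le_trans; apply. Qed.

Lemma exp_abs_le (a x : R) : expR (a * `|x|) <= expR (a * x) + expR ((- a) * x).
Proof.
have [x0|x0] := leP 0 x; first by rewrite ger0_norm // lerDl expR_ge0.
by rewrite ltr0_norm // mulrN mulNr lerDr expR_ge0.
Qed.

(** A combination of two exponentials dominating [exp (a |x|)], so its mean is
    read off the moment generating function. *)
Definition exp_weight (a x : R) : R := expR (a * x) + expR ((- a) * x).

Lemma exp_growth_weight a : exp_growth (exp_weight a).
Proof. by apply: exp_growthD; exact: exp_growth_exp. Qed.

Section Functional.
Variable E : (R -> R) -> R.
Hypothesis EE : mean_functional E.

Lemma mean_weight a : E (exp_weight a) = mgf E a + mgf E (- a).
Proof. by have [ED _ _ _] := EE; rewrite ED //; exact: exp_growth_exp. Qed.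

Lemma mean_le_weight f g eta a : exp_growth f -> exp_growth g ->
  (forall x, f x <= g x + eta * exp_weight a x) ->
  E f <= E g + eta * E (exp_weight a).
Proof.
have [ED EZ Ele _] := EE => gf gg fg.
rewrite -EZ; last exact: exp_growth_weight.
rewrite -ED //; last exact/exp_growthZ/exp_growth_weight.
apply: Ele => //; apply: exp_growthD => //.
exact/exp_growthZ/exp_growth_weight.
Qed.

Lemma mean_dist_weight f g eta a : exp_growth f -> exp_growth g ->
  (forall x, `|f x - g x| <= eta * exp_weight a x) ->
  `|E f - E g| <= eta * E (exp_weight a).
Proof.
move=> gf gg fg.
have h1 : E f <= E g + eta * E (exp_weight a).
  apply: mean_le_weight => // x.
  by have := fg x; rewrite ler_norml => /andP[]; lra.
have h2 : E g <= E f + eta * E (exp_weight a).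
  apply: mean_le_weight => // x.
  by have := fg x; rewrite ler_norml => /andP[]; lra.
by rewrite ler_norml; apply/andP; split; lra.
Qed.

Lemma exp_growth_cdf (c : R) : exp_growth (fun x => (x <= c)%R%:R : R).
Proof.
apply: exp_growth_bounded => [|x]; last by case: (x <= c); rewrite ?normr1 ?normr0.
rewrite (_ : (fun x => _) = \1_(`]-oo, c]%classic : set R)).
  by apply: measurable_indic; exact: measurable_itv.
by apply/funext => x; rewrite indicE mem_setE in_itv.
Qed.

Lemma exp_growth_cst c : exp_growth (fun=> c).
Proof.
rewrite (_ : (fun=> c) = (fun x => c * expR (0 * x))).
  exact/exp_growthZ/exp_growth_exp.
by apply/funext => x; rewrite mul0r expR0 mulr1.
Qed.

Lemma cdf_of_nd c c' : c <= c' -> cdf_of E c <= cdf_of E c'.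
Proof.
have [_ _ Ele _] := EE => cc'; apply: Ele => [||x]; try exact: exp_growth_cdf.
by rewrite ler_nat; case: (leP x c) => // /le_trans/(_ cc') ->.
Qed.

Lemma cdf_of_ge0 c : 0 <= cdf_of E c.
Proof.
have [_ EZ Ele _] := EE.
have <- : E (fun x => 0 * 1) = 0 by rewrite EZ ?mul0r //; exact: exp_growth_cst.
apply: Ele => [||x]; [exact/exp_growthZ/exp_growth_cst|exact: exp_growth_cdf|].
by rewrite mul0r.
Qed.

Lemma cdf_of_le1 c : cdf_of E c <= 1.
Proof.
have [_ _ Ele <-] := EE.
apply: Ele => [||x]; [exact: exp_growth_cdf|exact: exp_growth_cst|].
by case: (x <= c).
Qed.

Lemma cdf_of_lower_tail (L : R) : cdf_of E (- L) <= expR (- L) * mgf E (- 1).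
Proof.
have [_ EZ Ele _] := EE; rewrite -EZ; last exact: exp_growth_exp.
apply: Ele => [||x]; [exact: exp_growth_cdf|exact/exp_growthZ/exp_growth_exp|].
rewrite -expRD mulN1r; case: (leP x (- L)) => [xL|_]; last exact: expR_ge0.
by rewrite -expR0 ler_expR; lra.
Qed.

Lemma cdf_of_upper_tail (L : R) : 1 - cdf_of E L <= expR (- L) * mgf E 1.
Proof.
have [ED EZ Ele E1] := EE; rewrite lerBlDl -EZ; last exact: exp_growth_exp.
have g1 := exp_growth_cdf L; have g2 := exp_growthZ (expR (- L)) (exp_growth_exp 1).
have := ED _ _ g1 g2; rewrite /cdf_of => <-.
rewrite -[leLHS]E1; apply: Ele => [||x]; first exact: exp_growth_cst.
  exact: exp_growthD g1 g2.
rewrite -expRD mul1r; case: (leP x L) => [_|xL]; first by rewrite lerDl expR_ge0.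
by rewrite add0r -expR0 ler_expR; lra.
Qed.

End Functional.

(** Induction on the closure. At a limit, the approximation error costs the mean
    of a weight under both laws; closeness at [a] and [-a] bounds the one under
    [E] by the one under [G]. *)
Lemma exp_closure_determined (G : (R -> R) -> R) f : mean_functional G -> exp_closure f ->
  forall eps : R, 0 < eps -> exists (ts : seq R) (delta : R), 0 < delta /\
    forall E, mean_functional E -> mgf_close ts delta E G -> `|E f - G f| <= eps.
Proof.
move=> GE; elim=> {f} [t|f g fc IHf gc IHg|c f fc IH|a f g gc IH fg] eps eps0.
- by exists [:: t], eps; split=> // E _ /(_ t); rewrite inE eqxx => /(_ isT).
- have e2 : 0 < eps / 2 by rewrite divr_gt0.
  have [ts [d [d0 H]]] := IHf _ e2; have [ts' [d' [d'0 H']]] := IHg _ e2.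
  exists (ts ++ ts'), (Num.min d d'); split=> [|E EE cl]; first by rewrite lt_min d0.
  have [ED _ _ _] := EE; have [GD _ _ _] := GE.
  rewrite ED ?GD; try exact: exp_closure_growth.
  rewrite opprD addrACA [eps]splitr; apply: le_trans (ler_normD _ _) _; apply: lerD.
    apply: H => //; apply: mgf_close_sub cl => [t|]; first by rewrite mem_cat => ->.
    by rewrite ge_min lexx.
  apply: H' => //; apply: mgf_close_sub cl => [t|].
    by rewrite mem_cat => ->; rewrite orbT.
  by rewrite ge_min lexx orbT.
- have e2 : 0 < eps / (`|c| + 1) by rewrite divr_gt0 // ltr_pwDr.
  have [ts [d [d0 H]]] := IH _ e2; exists ts, d; split=> // E EE cl.
  have [_ EZ _ _] := EE; have [_ GZ _ _] := GE.
  rewrite EZ ?GZ; try exact: exp_closure_growth.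
  rewrite -mulrBr normrM; apply: le_trans (ler_wpM2l (normr_ge0 c) (H E EE cl)) _.
  rewrite mulrCA ler_piMr ?(ltW eps0) // ler_pdivrMr ?ltr_pwDr //.
  by rewrite mul1r lerDl.
- set M := 2 * G (exp_weight a%:R) + 2.
  have W0 : 0 <= G (exp_weight a%:R).
    have [_ GZ Gle _] := GE.
    have <- : G (fun x => 0 * 1) = 0 by rewrite GZ ?mul0r //; exact: exp_growth_cst.
    apply: Gle => [||x]; [exact/exp_growthZ/exp_growth_cst|exact: exp_growth_weight|].
    by rewrite mul0r addr_ge0 ?expR_ge0.
  have M0 : 0 < M by rewrite ltr_pwDr // mulr_ge0.
  have [k kP] : exists k : nat, k.+1%:R^-1 * M <= eps / 2.
    exists (Num.truncn (2 * M / eps)).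
    rewrite ler_pdivrMl // mulrC; have := truncnS_gt (2 * M / eps).
    rewrite ltr_pdivrMr // => /ltW; set q := _.+1%:R; lra.
  have e2 : 0 < eps / 2 by rewrite divr_gt0.
  have [ts [d [d0 H]]] := IH k _ e2.
  exists [:: a%:R, - a%:R & ts], (Num.min d 1).
  split=> [|E EE cl]; first by rewrite lt_min d0 ltr01.
  have Wd (F : (R -> R) -> R) : mean_functional F ->
      `|F f - F (g k)| <= k.+1%:R^-1 * F (exp_weight a%:R).
    move=> FE; apply: mean_dist_weight => //.
    - exact: (@exp_closure_growth f (exp_closure_limit gc fg)).
    - exact: exp_closure_growth.
    - move=> x; apply: le_trans (fg k x) _.
      by rewrite ler_wpM2l ?invr_ge0 // exp_abs_le.
  have EW : E (exp_weight a%:R) <= G (exp_weight a%:R) + 2.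
    rewrite (mean_weight EE) (mean_weight GE).
    have cl1 (t : R) : t \in [:: a%:R, - a%:R & ts] -> mgf E t <= mgf G t + 1.
      by move=> /cl; rewrite le_min => /andP[_]; rewrite ler_norml lerBlDl => /andP[_].
    have ca := cl1 a%:R; rewrite inE eqxx in ca.
    have cb := cl1 (- a%:R); rewrite !inE eqxx orbT in cb.
    apply: le_trans (lerD (ca isT) (cb isT)) _; rewrite addrACA; lra.
  have h1 := Wd _ EE; have h2 := Wd _ GE.
  have h3 : `|E (g k) - G (g k)| <= eps / 2.
    apply: H => //; apply: mgf_close_sub cl => [t|]; last by rewrite ge_min lexx.
    by rewrite !inE => ->; rewrite !orbT.
  have h4 : k.+1%:R^-1 * E (exp_weight a%:R) <= k.+1%:R^-1 * (G (exp_weight a%:R) + 2).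
    by rewrite ler_wpM2l ?invr_ge0.
  move: kP h1 h2 h3 h4; rewrite /M !ler_norml; move: (k.+1%:R^-1 : R) => u.
  by move=> ? /andP[? ?] /andP[? ?] /andP[? ?] ?; apply/andP; split; lra.
Qed.


(** The square wave [sharpen^k (sin ((x - c) / B))] is close to the sign of [x - c]
    for [tau <= |x - c| <= B]. Beyond [B] it is only known to be bounded, but there
    [eta exp |x| >= 1] by the choice of [B]. *)
Lemma step_approximation (c tau eta : R) : 0 < tau -> 0 < eta ->
  exists q, exp_closure q /\ forall x,
    (x <= c - tau)%R%:R <= q x + eta * expR `|x| /\
    q x <= (x <= c + tau)%R%:R + eta * expR `|x|.
Proof.
move=> tau0 eta0.
pose B := `|c| + eta^-1 + tau.
have B0 : 0 < B by rewrite !ltr_pwDr ?invr_gt0 // addr_ge0 ?invr_ge0 // ltW.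
have tB : tau / B <= 1 by rewrite ler_pdivrMr // mul1r /B lerDr addr_ge0 ?invr_ge0 // ltW.
have tB0 : 0 < tau / B by rewrite divr_gt0.
have [z] := @EVT_min R sin (tau / B) 1 tB
  (continuous_subspaceT (@continuous_sin R)).
rewrite in_itv /= => /andP[z1 z2] zmin; set e := sin z in zmin.
have e0 : 0 < e.
  apply: sin_gt0_pi; rewrite (lt_le_trans tB0 z1) /=.
  by apply: (@lt_le_trans _ _ 2); [lra|exact: pi_ge2].
have e1 : e <= 1 by exact: sin_le1.
have [k kP] : exists k, (1 - e / 2) ^+ k <= eta.
  have : (fun k => (1 - e / 2) ^+ k : R) @ \oo --> 0.
    by apply: cvg_expr; rewrite ger0_norm; lra.
  by move/cvgr_le => /(_ eta eta0) [m _ Hm]; exists m; apply: Hm => /=.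
pose s x := iter k (@sharpen R) (sin (B^-1 * x + (- (c / B)))).
pose q x := 2^-1 + (- 2^-1) * s x.
exists q; split.
  apply: exp_closure_add; first exact: exp_closure_cst.
  by apply/exp_closure_scale/trig_sum_closure/trig_sum_sharpen/trig_sum_sin.
have s1 x : -1 <= s x <= 1.
  by apply: iter_sharpen_itv; rewrite sin_geN1 sin_le1.
have far x : B < `|x - c| -> 1 <= eta * expR `|x|.
  move=> xc; rewrite -ler_pdivrMl // mulr1.
  apply: le_trans (expR_ge1Dx _).
  have := ler_normB x c; move: xc; rewrite /B => h1 h2.
  by apply: (@le_trans _ _ `|x|); lra.
have sE x : B^-1 * x + (- (c / B)) = (x - c) / B by rewrite mulrBl (mulrC x).
have near_s x : tau <= x - c -> x - c <= B -> 1 - s x <= eta.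
  move=> h1 h2; apply: le_trans kP.
  apply: (iter_sharpen_ge k (ltW e0) _).2.
  rewrite sin_le1 andbT zmin // sE in_itv /=.
  by rewrite ler_pM2r ?invr_gt0 // h1 ler_pdivrMr // mul1r.
have near_sN x : tau <= c - x -> c - x <= B -> 1 + s x <= eta.
  move=> h1 h2; apply: le_trans kP; rewrite -[s x]opprK -iter_sharpenN -sinN.
  apply: (iter_sharpen_ge k (ltW e0) _).2.
  rewrite sin_le1 andbT zmin // sE -mulNr opprB in_itv /=.
  by rewrite ler_pM2r ?invr_gt0 // h1 ler_pdivrMr // mul1r.
move=> x; have /andP[sl su] := s1 x.
have w1 : 1 <= expR `|x| by apply: le_trans (expR_ge1Dx _); rewrite lerDl.
have w2 : eta <= eta * expR `|x| by rewrite ler_peMr // ltW.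
have w0 : 0 <= eta * expR `|x| by rewrite mulr_ge0 ?expR_ge0 // ltW.
rewrite /q; split.
  have [xc|_] := leP x (c - tau); last by rewrite /=; lra.
  have [h|/far h] := leP `|x - c| B; last by rewrite /=; lra.
  have := near_sN x; rewrite distrC in h; have := le_trans (ler_norm _) h.
  move=> h1 /(_ _ h1) h2; have := h2 _; rewrite /= => h3.
  have : 1 + s x <= eta by apply: h3; lra.
  lra.
have [_|xc] := leP x (c + tau); first by rewrite /=; lra.
have [h|/far h] := leP `|x - c| B; last by rewrite /=; lra.
have h1 := le_trans (ler_norm _) h.
have : 1 - s x <= eta by apply: near_s => //; lra.
rewrite /=; lra.
Qed.

Section Comparison.
Variable G : (R -> R) -> R.
Hypothesis GE : mean_functional G.
Hypothesis Glip : forall c tau : R, 0 <= tau -> cdf_of G (c + tau) <= cdf_of G c + tau.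

Lemma mgf_ge0 (E : (R -> R) -> R) t : mean_functional E -> 0 <= mgf E t.
Proof.
move=> [_ EZ Ele _].
have <- : E (fun x => 0 * 1) = 0 by rewrite EZ ?mul0r //; exact: exp_growth_cst.
apply: Ele => [||x]; [exact/exp_growthZ/exp_growth_cst|exact: exp_growth_exp|].
by rewrite mul0r expR_ge0.
Qed.

(** Sandwich: the approximate step centred at [c + tau] lies above the step at [c]
    and below the step at [c + 2 tau], up to the weight; symmetrically for
    [c - tau]. The Lipschitz bound absorbs the shift. *)
Lemma cdf_close_at (c eps : R) : 0 < eps ->
  exists (ts : seq R) (delta : R), 0 < delta /\
    forall E, mean_functional E -> mgf_close ts delta E G ->
      `|cdf_of E c - cdf_of G c| <= eps.
Proof.
(* [M] bounds the mean of the weight under both laws: closeness within [1/2] at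
   [1] and [-1] adds at most [1]. *)
move=> eps0; pose M := mgf G 1 + mgf G (- 1) + 1.
have M0 : 0 < M by rewrite ltr_pwDr // addr_ge0 // mgf_ge0.
pose tau := eps / 8; have tau0 : 0 < tau by rewrite divr_gt0.
pose eta := eps / 8 / M; have eta0 : 0 < eta by rewrite !divr_gt0.
have etaM : eta * M = eps / 8 by rewrite /eta divfK // gt_eqF.
have e4 : 0 < eps / 4 by rewrite divr_gt0.
have [q1 [q1c q1P]] := step_approximation (c + tau) tau0 eta0.
have [q2 [q2c q2P]] := step_approximation (c - tau) tau0 eta0.
have [ts1 [d1 [d10 H1]]] := exp_closure_determined GE q1c e4.
have [ts2 [d2 [d20 H2]]] := exp_closure_determined GE q2c e4.
exists ([:: 1, - 1 & ts1 ++ ts2]), (Num.min (2^-1) (Num.min d1 d2)); split.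
  by rewrite !lt_min invr_gt0 ltr0n d10.
move=> E EE cl.
have {}H1 : `|E q1 - G q1| <= eps / 4.
  apply: H1 => //; apply: mgf_close_sub cl => [t t1|].
    by rewrite !inE mem_cat t1 !orbT.
  by rewrite !ge_min lexx ?orbT.
have {}H2 : `|E q2 - G q2| <= eps / 4.
  apply: H2 => //; apply: mgf_close_sub cl => [t t1|].
    by rewrite !inE mem_cat t1 !orbT.
  by rewrite !ge_min lexx ?orbT.
have cl1 (t : R) : t \in [:: 1, - 1 & ts1 ++ ts2] -> mgf E t <= mgf G t + 2^-1.
  by move=> /cl; rewrite le_min => /andP[+ _]; rewrite ler_norml lerBlDl => /andP[_].
have WE : eta * E (exp_weight 1) <= eps / 8.
  rewrite -etaM ler_wpM2l ?(ltW eta0) // (mean_weight EE) /M.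
  have := cl1 1; rewrite inE eqxx => /(_ isT).
  have := cl1 (- 1); rewrite !inE eqxx orbT => /(_ isT) ? ?; lra.
have WG : eta * G (exp_weight 1) <= eps / 8.
  by rewrite -etaM ler_wpM2l ?(ltW eta0) // (mean_weight GE) /M lerDl.
have wle x : eta * expR `|x| <= eta * exp_weight 1 x.
  by rewrite ler_wpM2l ?(ltW eta0) // -[`|x|]mul1r exp_abs_le.
have g1 := exp_closure_growth q1c; have g2 := exp_closure_growth q2c.
have gc := exp_growth_cdf.
have upE : cdf_of E c <= E q1 + eta * E (exp_weight 1).
  apply: mean_le_weight => // x.
  by have := (q1P x).1; rewrite addrK => /le_trans; apply; rewrite lerD2l.
have upG : G q1 <= cdf_of G (c + tau + tau) + eta * G (exp_weight 1).
  apply: mean_le_weight => // x.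
  by have := (q1P x).2 => /le_trans; apply; rewrite lerD2l.
have loE : E q2 <= cdf_of E c + eta * E (exp_weight 1).
  apply: mean_le_weight => // x.
  by have := (q2P x).2; rewrite subrK => /le_trans; apply; rewrite lerD2l.
have loG : cdf_of G (c - tau - tau) <= G q2 + eta * G (exp_weight 1).
  apply: mean_le_weight => // x.
  by have := (q2P x).1 => /le_trans; apply; rewrite lerD2l.
have l1 := Glip (c + tau) (ltW tau0); have l2 := Glip c (ltW tau0).
have := Glip (c - tau - tau) (ltW tau0); have := Glip (c - tau) (ltW tau0).
rewrite !subrK => l3 l4.
move: H1 H2; rewrite !ler_norml => /andP[? ?] /andP[? ?].
by apply/andP; split; rewrite /tau in l1 l2 l3 l4; lra.
Qed.

Lemma cdf_close_finite (cs : seq R) (eps : R) : 0 < eps ->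
  exists (ts : seq R) (delta : R), 0 < delta /\
    forall E, mean_functional E -> mgf_close ts delta E G ->
      forall c, c \in cs -> `|cdf_of E c - cdf_of G c| <= eps.
Proof.
move=> eps0; elim: cs => [|c cs [ts [d [d0 H]]]]; first by exists [::], 1.
have [ts' [d' [d'0 H']]] := cdf_close_at c eps0.
exists (ts ++ ts'), (Num.min d d'); split; first by rewrite lt_min d0.
move=> E EE cl b; rewrite inE => /predU1P[->|bcs].
  apply: H' => //; apply: mgf_close_sub cl => [t|]; last by rewrite ge_min lexx orbT.
  by rewrite mem_cat orbC => ->.
apply: H => //; apply: mgf_close_sub cl => [t|]; last by rewrite ge_min lexx.
by rewrite mem_cat => ->.
Qed.

(** Closeness on a grid of mesh [eps / 4] reaching into both tails suffices, since
    distribution functions are monotone and the one of [G] is Lipschitz. *)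
Theorem mgf_determines_cdf (eps : R) : 0 < eps ->
  exists (ts : seq R) (delta : R), 0 < delta /\
    forall E, mean_functional E -> mgf_close ts delta E G ->
      forall c, `|cdf_of E c - cdf_of G c| <= eps.
Proof.
move=> eps0; pose e := eps / 4; have e0 : 0 < e by rewrite divr_gt0.
pose L := (mgf G 1 + mgf G (- 1)) / e.
have m1 := mgf_ge0 1 GE; have m2 := mgf_ge0 (- 1) GE.
have L0 : 0 <= L by rewrite divr_ge0 ?addr_ge0 // ltW.
have expL : expR (- L) * (mgf G 1 + mgf G (- 1)) <= e.
  rewrite expRN ler_pdivrMl ?expR_gt0 // -ler_pdivrMr //.
  by apply: le_trans (expR_ge1Dx _); rewrite -/L; lra.
have lowG : cdf_of G (- L) <= e.
  apply: le_trans (cdf_of_lower_tail GE L) _; apply: le_trans expL.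
  by rewrite ler_wpM2l ?expR_ge0 // lerDr.
have upG : 1 - cdf_of G L <= e.
  apply: le_trans (cdf_of_upper_tail GE L) _; apply: le_trans expL.
  by rewrite ler_wpM2l ?expR_ge0 // lerDl.
pose m := (Num.truncn (2 * L / e)).+1.
pose c (i : nat) : R := - L + i%:R * e.
have cm : L <= c m.
  have := truncnS_gt (2 * L / e); rewrite -/m ltr_pdivrMr // /c => ?; lra.
have [ts [d [d0 H]]] := cdf_close_finite [seq c i | i <- iota 0 m.+1] e0.
exists ts, d; split=> // E EE cl b.
have {}H i : (i <= m)%N -> `|cdf_of E (c i) - cdf_of G (c i)| <= e.
  by move=> im; apply: H => //; apply/map_f; rewrite mem_iota.
have c0 : c 0%N = - L by rewrite /c mul0r addr0.
have ee : eps = 4 * e by rewrite /e; field.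
have E0 := cdf_of_ge0 EE b; have E1 := cdf_of_le1 EE b.
have G0 := cdf_of_ge0 GE b; have G1 := cdf_of_le1 GE b.
have [bl|bl] := leP b (- L).
  have := H 0%N isT; rewrite c0 ler_norml => /andP[h1 h2].
  have h3 := cdf_of_nd EE bl; have h4 := cdf_of_nd GE bl.
  by rewrite ler_norml; apply/andP; split; lra.
have [br|br] := leP (c m) b.
  have := H m (leqnn m); rewrite ler_norml => /andP[h1 h2].
  have h3 := cdf_of_nd EE br; have h4 := cdf_of_nd GE br.
  have h5 := cdf_of_nd GE cm.
  by rewrite ler_norml; apply/andP; split; lra.
pose i := Num.truncn ((b + L) / e).
have bL : 0 <= (b + L) / e by rewrite divr_ge0 //; lra.
have /andP[il iu] := truncn_itv bL; rewrite -/i in il iu.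
have im : (i < m)%N.
  rewrite -(ltr_nat R); apply: le_lt_trans il _.
  by rewrite ltr_pdivrMr //; rewrite /c in br; lra.
rewrite ler_pdivlMr // in il; rewrite ltr_pdivrMr // in iu.
have ib : c i <= b by rewrite /c; lra.
have bi : b <= c i.+1 by rewrite /c; lra.
have := H _ (ltnW im); have := H _ im.
have h1 := cdf_of_nd EE ib; have h2 := cdf_of_nd EE bi.
have h3 := cdf_of_nd GE ib; have h4 := cdf_of_nd GE bi.
have h5 := Glip (c i) (ltW e0).
have ci : c i + e = c i.+1 by rewrite /c -natr1; ring.
rewrite ci in h5; rewrite !ler_norml => /andP[? ?] /andP[? ?].
by apply/andP; split; lra.
Qed.

End Comparison.

End Expectation.

(** * Laws with a density, and the Gaussian law *)

Section Weighted.
Context (R : realType) (d : measure_display) (T : measurableType d)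
  (mu : {measure set T -> \bar R}) (D : set T) (V rho : T -> R).
Hypotheses (mD : measurable D) (mV : measurable_fun D V)
  (mrho : measurable_fun D rho) (rho0 : forall x, D x -> 0 <= rho x)
  (int_exp : forall t, mu.-integrable D (fun x => (expR (t * V x) * rho x)%:E))
  (rho1 : (\int[mu]_(x in D) (rho x)%:E = 1)%E).

(** The law of [V] under the measure with density [rho] on [D]. *)
Definition weighted_mean (f : R -> R) : R := (\int[mu]_(x in D) (f (V x) * rho x))%R.

Lemma integrable_weighted f : exp_growth f ->
  mu.-integrable D (fun x => (f (V x) * rho x)%:E).
Proof.
move=> [mf [k fk]].
have ik : mu.-integrable D (fun x =>
    (k%:R)%:E * ((expR (k%:R * V x) * rho x)%:E + (expR ((- k%:R) * V x) * rho x)%:E))%E.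
  by apply: integrableZl => //; apply: integrableD => //; exact: int_exp.
apply: le_integrable ik => //.
  apply/measurable_EFinP; apply: measurable_funM => //.
  by apply: (measurable_comp (F := setT)) => //; exact: measurableT.
move=> x Dx; rewrite -EFinD -EFinM /= lee_fin normrM (ger0_norm (rho0 Dx)).
rewrite -mulrDl mulrA normrM (ger0_norm (rho0 Dx)) ler_wpM2r ?rho0 //.
apply: le_trans (fk _) _; apply: le_trans (ler_norm _).
by rewrite ler_wpM2l // exp_abs_le.
Qed.

Lemma mean_functional_weighted : mean_functional weighted_mean.
Proof.
split=> [f g gf gg|c f gf|f g gf gg fg|].
- rewrite /weighted_mean -RintegralD //; try exact: integrable_weighted.
  by apply: eq_Rintegral => x _; rewrite mulrDl.
- rewrite /weighted_mean -RintegralZl //; try exact: integrable_weighted.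
  by apply: eq_Rintegral => x _; rewrite mulrA.
- apply: le_Rintegral => //; try exact: integrable_weighted.
  by move=> x Dx; rewrite ler_wpM2r ?rho0.
- rewrite /weighted_mean /Rintegral; under eq_integral do rewrite mul1r.
  by rewrite rho1.
Qed.

End Weighted.

Section Gaussian.
Context (R : realType).
Notation mu := (@lebesgue_measure R).

Definition gaussian_mean : (R -> R) -> R :=
  weighted_mean mu setT id (normal_pdf 0 1).

(** Completing the square. *)
Lemma normal_pdf_tilt (t x : R) :
  expR (t * x) * normal_pdf 0 1 x = expR (t ^+ 2 / 2) * normal_pdf t 1 x.
Proof.
rewrite /normal_pdf (negbTE (oner_neq0 R)) /normal_fun mulrCA [RHS]mulrCA.
congr (_ * _); rewrite -!expRD; congr expR.
by rewrite expr1n subr0; field.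
Qed.

Lemma integrable_exp_normal t :
  mu.-integrable setT (fun x => (expR (t * id x) * normal_pdf 0 1 x)%:E).
Proof.
rewrite (_ : (fun x => _) = (fun x => (expR (t ^+ 2 / 2))%:E * (normal_pdf t 1 x)%:E)%E).
  by apply: integrableZl => //; exact: integrable_normal_pdf.
by apply/funext => x; rewrite normal_pdf_tilt EFinM.
Qed.

Lemma mean_functional_gaussian : mean_functional gaussian_mean.
Proof.
apply: mean_functional_weighted => //.
- exact: measurable_normal_pdf.
- by move=> x _; exact: normal_pdf_ge0.
- exact: integrable_exp_normal.
- exact: integral_normal_pdf.
Qed.

Lemma mgf_gaussian t : mgf gaussian_mean t = expR (t ^+ 2 / 2).
Proof.
rewrite /mgf /gaussian_mean /weighted_mean.
under eq_Rintegral do rewrite normal_pdf_tilt.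
rewrite RintegralZl //; last exact: integrable_normal_pdf.
by rewrite /Rintegral integral_normal_pdf mulr1.
Qed.

Lemma le_set_itv (c : R) : [set x : R | x <= c] = `]-oo, c]%classic.
Proof. by rewrite set_itvE. Qed.

Lemma cdf_gaussian c : cdf_of gaussian_mean c = std_normal_cdf c.
Proof.
rewrite /cdf_of /gaussian_mean /weighted_mean /std_normal_cdf /normal_prob.
rewrite /Rintegral; congr fine; rewrite [RHS]integral_mkcond; apply: eq_integral => x _.
rewrite patchE; have [xc|xc] := leP x c.
  by rewrite mul1r mem_set.
by rewrite mul0r memNset // => /=; rewrite leNgt xc.
Qed.

(** The density is at most [1 / sqrt (2 pi) <= 1]. *)
Lemma cdf_gaussian_lipschitz (c tau : R) : 0 <= tau ->
  cdf_of gaussian_mean (c + tau) <= cdf_of gaussian_mean c + tau.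
Proof.
move=> tau0; rewrite !cdf_gaussian /std_normal_cdf !le_set_itv.
have -> : `]-oo, c + tau]%classic = `]-oo, c]%classic `|` `]c, c + tau]%classic :> set R.
  apply/seteqP; split=> x /=; rewrite !in_itv /=.
    by have [xc|xc] := leP x c; [left|right].
  by case=> [xc|/andP[]//]; rewrite (le_trans xc) // lerDl.
rewrite measureU //; last first.
  apply/seteqP; split=> x //=; rewrite !in_itv /= => -[xc /andP[]].
  by rewrite ltNge xc.
rewrite fineD ?fin_num_measure //; rewrite lerD2l.
rewrite -[leRHS]/(fine tau%:E); apply: fine_le; [exact: fin_num_measure|by []|].
change (\int[mu]_(x in `]c, (c + tau)%R]) (normal_pdf 0 1 x)%:E <= tau%:E)%E.
apply: (@le_trans _ _ (\int[mu]_(x in `]c, (c + tau)%R]) (cst 1%:E x))%E).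
  apply: ge0_le_integral => //.
  - by move=> x _; rewrite lee_fin normal_pdf_ge0.
  - by apply/measurable_EFinP; apply: measurable_funTS; exact: measurable_normal_pdf.
  - move=> x _; rewrite lee_fin; apply: le_trans (normal_pdf_ub _ _ (oner_neq0 R)) _.
    rewrite /normal_peak invf_le1.
      rewrite -[leLHS]sqrtr1 ler_wsqrtr // expr1n mul1r mulr2n.
      by have := pi_ge2 R; lra.
    by rewrite sqrtr_gt0 expr1n mul1r mulrn_wgt0 // pi_gt0.
rewrite integral_cst //= mul1e lebesgue_measure_itv /= lte_fin.
case: ifP => _; last by rewrite lee_fin.
by rewrite -EFinD lee_fin addrAC subrr add0r.
Qed.

End Gaussian.

(** * Borel measurability on matrices *)

Section MatrixContinuity.
Context (R : realType) (X : topologicalType).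

Lemma continuous_bigsum (I : Type) (s : seq I) (F : I -> X -> R) :
  (forall i, continuous (F i)) -> continuous (fun x => \sum_(i <- s) F i x).
Proof.
move=> cF; elim: s => [|i s IH] x.
  by under eq_fun do rewrite big_nil; exact: cvg_cst.
under eq_fun do rewrite big_cons.
by apply: cvgD; [exact: cF|exact: IH].
Qed.

Lemma continuous_bigprod (I : Type) (s : seq I) (F : I -> X -> R) :
  (forall i, continuous (F i)) -> continuous (fun x => \prod_(i <- s) F i x).
Proof.
move=> cF; elim: s => [|i s IH] x.
  by under eq_fun do rewrite big_nil; exact: cvg_cst.
under eq_fun do rewrite big_cons.
by apply: cvgM; [exact: cF|exact: IH].
Qed.

Lemma continuous_det p (f : X -> 'M[R]_p) :
  (forall i j, continuous (fun x => f x i j)) -> continuous (fun x => \det (f x)).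
Proof.
move=> cf; apply: continuous_bigsum => s x; apply: cvgM; first exact: cvg_cst.
by apply: continuous_bigprod => i; exact: cf.
Qed.

Lemma continuous_adj p (f : X -> 'M[R]_p) i j :
  (forall i j, continuous (fun x => f x i j)) -> continuous (fun x => (\adj (f x)) i j).
Proof.
move=> cf.
rewrite (_ : (fun x => _) =
    (fun x => (-1) ^+ (j + i) * \det (row' j (col' i (f x))))); last first.
  by apply/funext => x; rewrite mxE.
move=> x; apply: cvgM; first exact: cvg_cst.
apply: continuous_det => k l.
rewrite (_ : (fun x => _) = (fun x => f x (lift j k) (lift i l))); first exact: cf.
by apply/funext => y; rewrite !mxE.
Qed.

Lemma continuous_mx_entries m n (f : X -> 'M[R]_(m, n)) (x : X) :
  (forall i j, {for x, continuous (fun y => f y i j)}) -> {for x, continuous f}.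
Proof.
move=> fM; apply/cvg_mx_entourageP => A entA.
apply: filter_forall => i; apply: filter_forall => j.
have := (cvg_app_entourageP _ (nbhs_filter x) _).1 (fM i j) A entA.
by apply: filterS => y yA; apply/mem_set.
Qed.

End MatrixContinuity.

Section BorelMatrices.
Context (R : realType).

Lemma open_borel_mx m n (U : set 'M[R]_(m, n)) : open U ->
  measurable (U : set (borel_mx R m n)).
Proof. by move=> oU; exact: sub_sigma_algebra. Qed.

Lemma closed_borel_mx m n (U : set 'M[R]_(m, n)) : closed U ->
  measurable (U : set (borel_mx R m n)).
Proof.
move=> cU; rewrite -[U]setCK; apply: measurableC.
by apply: open_borel_mx; exact: closed_openC.
Qed.

Lemma continuous_measurable_mx m n (f : 'M[R]_(m, n) -> R) : continuous f ->
  measurable_fun setT (f : borel_mx R m n -> R).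
Proof.
move=> cf; apply: (measurability _ (RGenOInfty.measurableE R)).
move=> _ [_ [x ->] <-]; rewrite setTI; apply: open_borel_mx.
by apply: open_comp => [y _|]; [exact: cf|exact: interval_open].
Qed.

(** Positive definite means symmetric, positive semidefinite and invertible: two
    closed conditions and an open one, which avoids a compactness argument on the
    unit sphere. *)
Lemma measurable_posdefmx p : measurable (@posdefmx R p : set (borel_mx R p p)).
Proof.
have -> : @posdefmx R p = [set A | A^T = A] `&` [set A | forall x, 0 <= quad_form A x]
    `&` [set A | \det A != 0].
  apply/seteqP; split => [A Apos|A [[/= AT Apsd] detA]].
    have [AT Anng] := posdefmx_psd Apos.
    by have := posdefmx_unit Apos; rewrite unitmxE unitfE.
  have [[rT _] rr] := mxsqrtP (conj AT Apsd); split => // x x0.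
  rewrite lt_def Apsd andbT quad_formE -rr -mulmxA mulmxA -[in X in X *m _]rT -trmx_mul.
  rewrite cV_dot_eq0; apply: contraNneq x0 => rx0.
  have Au : A \in unitmx by rewrite unitmxE unitfE.
  by rewrite -(mulKmx Au x) -rr -mulmxA rx0 !mulmx0.
apply: measurableI; first apply: measurableI.
- rewrite (_ : [set A | _] = \bigcap_(ij in [set: 'I_p * 'I_p])
      [set A : 'M[R]_p | A ij.1 ij.2 - A ij.2 ij.1 = 0]).
    apply: closed_borel_mx; apply: closed_bigI => -[i j] _ /=.
    apply: (@preimage_closed _ _ (fun A : 'M[R]_p => A i j - A j i) [set 0]).
      by move=> A _; apply: continuousB; exact: coord_continuous.
    exact: closed_eq.
  apply/seteqP; split=> [A /= AT [i j] _ /=|A /= H].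
    by rewrite -{1}AT mxE subrr.
  by apply/matrixP => i j; rewrite mxE; apply/eqP; rewrite -subr_eq0 (H (j, i) I).
- rewrite (_ : [set A | _] = \bigcap_(x in [set: 'cV[R]_p])
      [set A : 'M[R]_p | 0 <= quad_form A x]); last first.
    by apply/seteqP; split=> [A /= H x _|A /= H x]; exact: H.
  apply: closed_borel_mx; apply: closed_bigI => x _ /=.
  apply: (@preimage_closed _ _ (fun A : 'M[R]_p => quad_form A x) [set y | 0 <= y]).
    rewrite (_ : (fun A => _) = fun A : 'M[R]_p => \sum_j (\sum_i x i 0 * A i j) * x j 0).
      move=> B _; apply: continuous_bigsum => j A; apply: continuousM; last exact: cst_continuous.
      apply: continuous_bigsum => i C; apply: continuousM; first exact: cst_continuous.
      exact: coord_continuous.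
    apply/funext => A; rewrite /quad_form mxE; apply: eq_bigr => j _; rewrite mxE.
    by congr (_ * _); apply: eq_bigr => i _; rewrite mxE.
  exact: closed_ge.
- apply: open_borel_mx.
  apply: (@open_comp _ _ (fun A : 'M[R]_p => \det A) [set y | y != 0]).
    by move=> A _; apply: continuous_det => i j; exact: coord_continuous.
  exact: open_neq.
Qed.

(** By Cramer's rule the inverse is continuous on the open set of invertible
    matrices. *)
Lemma measurable_invmx_posdef p :
  measurable_fun (@posdefmx R p : set (borel_mx R p p))
    (@invmx R p : borel_mx R p p -> borel_mx R p p).
Proof.
apply: (@measurability _ _ (borel_mx R p p) (borel_mx R p p) _ _ (@open 'M[R]_p)) => //.
move=> _ [U oU <-].
pose g (A : 'M[R]_p) : 'M[R]_p := (\det A)^-1 *: \adj A.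
pose W := [set A : 'M[R]_p | \det A != 0 /\ U (g A)].
have -> : @posdefmx R p `&` @invmx R p @^-1` U = @posdefmx R p `&` W.
  apply/seteqP; split=> A [Apos /=]; have Au := posdefmx_unit Apos; rewrite /invmx Au.
    by move=> UA; split=> //; split=> //; move: Au; rewrite unitmxE unitfE.
  by move=> [_ UA].
apply: measurableI; first exact: measurable_posdefmx.
apply: open_borel_mx; rewrite openE => A [dA UA].
have cdet : continuous (fun A : 'M[R]_p => \det A).
  by apply: continuous_det => i j; exact: coord_continuous.
have gA : {for A, continuous g}.
  apply: continuous_mx_entries => i j.
  rewrite (_ : (fun x => _) = (fun x => (\det x)^-1 * (\adj x) i j)).
    apply: continuousM; first by apply: continuousV => //; exact: cdet.
    by apply: continuous_adj => k l; exact: coord_continuous.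
  by apply/funext => x; rewrite mxE.
have h1 : \forall x \near A, U (g x) by apply: gA; exact: open_nbhs_nbhs.
have h2 : \forall x \near A, \det x != 0.
  have : \forall y \near \det A, y != 0 by apply: open_nbhs_nbhs; split => //; exact: open_neq.
  exact: cdet.
by apply: filterS2 h2 h1.
Qed.

Lemma continuous_trace_mul p (S : 'M[R]_p) (X : topologicalType) (f : X -> 'M[R]_p) :
  (forall i j, continuous (fun x => f x i j)) -> continuous (fun x => \tr (f x *m S)).
Proof.
move=> cf; rewrite (_ : (fun x => _) = fun x => \sum_i \sum_j f x i j * S j i).
  apply: continuous_bigsum => i; apply: continuous_bigsum => j x.
  by apply: cvgM; [exact: cf|exact: cvg_cst].
by apply/funext => x; apply: eq_bigr => i _; rewrite mxE.
Qed.

Lemma measurable_loglik_shift n p (S M : 'M[R]_p) :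
  measurable_fun setT ((fun Omega => loglik n S (Omega + M)) : borel_mx R p p -> R).
Proof.
have cf i j : continuous (fun A : 'M[R]_p => (A + M) i j).
  rewrite (_ : (fun A => _) = fun A : 'M[R]_p => A i j + M i j).
    by move=> A; apply: continuousD; [exact: coord_continuous|exact: cst_continuous].
  by apply/funext => A; rewrite mxE.
apply: measurable_funB; apply: measurable_funM => //.
  apply: measurableT_comp; first exact: measurable_ln.
  by apply: continuous_measurable_mx; exact: continuous_det.
by apply: continuous_measurable_mx; exact: continuous_trace_mul.
Qed.

Lemma measurable_trace_mul p (S : 'M[R]_p) :
  measurable_fun setT ((fun A => \tr (A *m S)) : borel_mx R p p -> R).
Proof.
apply: continuous_measurable_mx.
by apply: continuous_trace_mul => i j; exact: coord_continuous.
Qed.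

End BorelMatrices.

(** * Outer probability *)

Section OuterProbability.
Context (R : realType) (d : measure_display) (T : measurableType d) (P : probability T R).

Lemma outer_probability_ge0 (A : set T) : (0 <= outer_probability P A)%E.
Proof. by apply: le_ereal_inf_tmp => _ [E _ <-]; exact: measure_ge0. Qed.

Lemma le_outer_probability (A B : set T) : A `<=` B ->
  (outer_probability P A <= outer_probability P B)%E.
Proof.
move=> AB; apply: le_ereal_inf_tmp => _ [E [mE BE] <-].
by apply: ereal_inf_lbound; exists E => //; split => //; exact: subset_trans BE.
Qed.

Lemma outer_probabilityU (A B : set T) :
  (outer_probability P (A `|` B) <= outer_probability P A + outer_probability P B)%E.
Proof.
have fin C : outer_probability P C \is a fin_num.
  rewrite ge0_fin_numE ?outer_probability_ge0 //.
  apply: (@le_lt_trans _ _ (P setT)); last by rewrite probability_setT ltry.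
  by apply: ereal_inf_lbound; exists setT.
apply/lee_addgt0Pr => e e0.
have e2 : 0 < e / 2 by rewrite divr_gt0.
have /(lb_ereal_inf_adherent e2)[_ [E [mE AE] <-] PE] := fin A.
have /(lb_ereal_inf_adherent e2)[_ [F [mF BF] <-] PF] := fin B.
apply: (@le_trans _ _ (P (E `|` F))).
  apply: ereal_inf_lbound; exists (E `|` F) => //; split; first exact: measurableU.
  exact: setUSS.
apply: le_trans (measureU2 _ mE mF) _.
rewrite [e]splitr EFinD addeACA; apply: leeD; exact: ltW.
Qed.

End OuterProbability.

Section Vanishing.
Context (R : realType) (d : nat -> measure_display) (T : forall n, measurableType (d n))
  (P : forall n, probability (T n) R).

Definition vanishing (A : forall n, set (T n)) : Prop :=
  (fun n => outer_probability (P n) (A n)) @ \oo --> 0%E.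

Lemma vanishing_sub (A B : forall n, set (T n)) :
  (\forall n \near \oo, A n `<=` B n) -> vanishing B -> vanishing A.
Proof.
move=> AB vB; apply: (@squeeze_cvge _ _ _ _ (cst 0%E) _ _ _ _ _ vB); last exact: cvg_cst.
by apply: filterS AB => n AB; rewrite outer_probability_ge0 le_outer_probability.
Qed.

Lemma vanishingU (A B : forall n, set (T n)) :
  vanishing A -> vanishing B -> vanishing (fun n => A n `|` B n).
Proof.
move=> vA vB; apply: (@squeeze_cvge _ _ _ _ (cst 0%E) _
  (fun n => outer_probability (P n) (A n) + outer_probability (P n) (B n))%E).
- by apply: nearW => n; rewrite outer_probability_ge0 outer_probabilityU.
- exact: cvg_cst.
- by rewrite -[0%E]add0e; apply: cvgeD.
Qed.

Lemma vanishing0 : vanishing (fun n => set0).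
Proof.
rewrite /vanishing (_ : (fun n => _) = cst 0%E); first exact: cvg_cst.
by apply/funext => n; rewrite outer_probabilityE // measure0.
Qed.

Lemma vanishing_bigcup_seq (I : eqType) (s : seq I) (A : I -> forall n, set (T n)) :
  (forall i, i \in s -> vanishing (A i)) ->
  vanishing (fun n => [set w | exists2 i, i \in s & A i n w]).
Proof.
elim: s => [|i s IH] vA.
  by apply: vanishing_sub vanishing0; apply: nearW => n w [].
apply: (@vanishing_sub _ (fun n => A i n `|` [set w | exists2 j, j \in s & A j n w])).
  apply: nearW => n w [j]; rewrite inE => /predU1P[->|js] Aj; [by left|right].
  by exists j.
apply: vanishingU; first by apply: vA; rewrite mem_head.
by apply: IH => j js; apply: vA; rewrite inE js orbT.
Qed.

End Vanishing.

(** * The posterior for a fixed sample *)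

Lemma posdefmx_inv (R : realType) p (A : 'M[R]_p) : posdefmx A -> posdefmx (invmx A).
Proof.
move=> Apos; have Au := posdefmx_unit Apos; have [AT Ap] := Apos.
split; first by rewrite trmx_inv AT.
move=> x x0; have := Ap (invmx A *m x).
rewrite /quad_form trmx_mul trmx_inv AT !mulmxA mulmxKV //; apply.
by apply: contraNneq x0 => e; rewrite -(mulKVmx Au x) e mulmx0.
Qed.

Section FixedSample.
Context (R : realType) (p n : nat) (SigmaStar Phi S : 'M[R]_p) (A : set 'M[R]_p)
  (Pi : probability (borel_mx R p p) R).
Hypotheses (Spos : posdefmx SigmaStar) (PhiT : Phi^T = Phi) (Phi0 : Phi != 0)
  (n0 : (0 < n)%N)
  (mA : measurable (A : set (borel_mx R p p))) (Apos : A `<=` @posdefmx R p).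
Let s := frobenius_norm (mxsqrt SigmaStar *m Phi *m mxsqrt SigmaStar).

(** The standardized linear functional whose posterior law is compared with
    [N(0,1)]. *)
Definition linear_stat (Omega : 'M[R]_p) : R :=
  Num.sqrt n%:R * \tr ((invmx Omega - S) *m Phi) / (Num.sqrt 2 * s).

Definition lik (Omega : 'M[R]_p) : R := expR (loglik n S Omega).

Definition lik_mass (B : set 'M[R]_p) : R := fine (lik_integral n Pi S id B).

(** The law of the linear statistic under the posterior conditioned on [A]. *)
Definition restricted_mean : (R -> R) -> R :=
  @weighted_mean R _ (borel_mx R p p) Pi A linear_stat (fun Omega => lik Omega / lik_mass A).

Lemma measurable_lik_shift M :
  measurable_fun setT ((fun Omega => lik (Omega + M)) : borel_mx R p p -> R).
Proof.
apply: measurableT_comp; first exact: measurable_expR.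
exact: measurable_loglik_shift.
Qed.

Lemma measurable_lik : measurable_fun setT (lik : borel_mx R p p -> R).
Proof.
have := measurable_lik_shift 0.
by rewrite (_ : (fun Omega => _) = lik) //; apply/funext => Omega; rewrite addr0.
Qed.

Lemma measurable_linear_stat :
  measurable_fun (@posdefmx R p : set (borel_mx R p p))
    (linear_stat : borel_mx R p p -> R).
Proof.
apply: measurable_funM => //; apply: measurable_funM => //.
rewrite (_ : (fun Omega => _) =
   (fun Omega => \tr (invmx Omega *m Phi) - \tr (S *m Phi))); last first.
  by apply/funext => Omega; rewrite mulmxBl raddfB.
apply: measurable_funB => //.
apply: (@measurable_comp _ _ _ (borel_mx R p p) (borel_mx R p p) _ setT
   (fun Sigma : 'M[R]_p => \tr (Sigma *m Phi))) => //.
  exact: measurable_trace_mul.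
exact: measurable_invmx_posdef.
Qed.

(** Since [fine] sends infinite values to [0], a positive mass certifies that the
    integral is finite. *)
Lemma lik_mass_gt0 B : 0 < lik_mass B ->
  [/\ (0 < lik_integral n Pi S id B)%E, lik_integral n Pi S id B \is a fin_num
    & lik_integral n Pi S id B = (lik_mass B)%:E].
Proof.
rewrite /lik_mass; case: (lik_integral n Pi S id B) => [r||] //=; last 2 first.
  by rewrite ltxx.
by rewrite ltxx.
Qed.

Lemma integrable_lik B : measurable (B : set (borel_mx R p p)) -> 0 < lik_mass B ->
  (Pi : measure _ R).-integrable (B : set (borel_mx R p p)) (EFin \o lik).
Proof.
move=> mB /lik_mass_gt0[_ fin _]; apply/integrableP; split.
  by apply/measurable_EFinP; apply: measurable_funTS; exact: measurable_lik.
rewrite [ltLHS](_ : _ = lik_integral n Pi S id B).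
  by move: fin; rewrite fin_numElt => /andP[].
by apply: eq_integral => Omega _; rewrite /= ger0_norm ?expR_ge0.
Qed.

Section Bounded.
Hypotheses (mass0 : 0 < lik_mass A) (kappa : R)
  (bounded : exists M, forall Omega, A Omega -> `|linear_stat Omega| <= M)
  (kappa1 : kappa <= 1)
  (trace_close : forall Omega, A Omega -> let Sigma := invmx Omega in
    `|\tr (Sigma *m Phi *m Sigma *m Phi) - s ^+ 2| <= kappa * s ^+ 2).

(** All exponential moments are finite because the statistic is bounded on [A]. *)
Lemma integrable_exp_linear_stat t : (Pi : measure _ R).-integrable
  (A : set (borel_mx R p p))
  (fun Omega => (expR (t * linear_stat Omega) * (lik Omega / lik_mass A))%:E).
Proof.
have [M HM] := bounded.
have i1 : (Pi : measure _ R).-integrable (A : set (borel_mx R p p))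
    (fun Omega => ((expR (`|t| * M) / lik_mass A)%:E * (lik Omega)%:E)%E).
  by apply: integrableZl => //; exact: integrable_lik.
apply: le_integrable i1 => //.
  apply/measurable_EFinP; apply: measurable_funM.
    apply: measurableT_comp; first exact: measurable_expR.
    apply: measurable_funM => //.
    by apply: measurable_funS measurable_linear_stat => //; exact: measurable_posdefmx.
  by apply: measurable_funM => //; apply: measurable_funTS; exact: measurable_lik.
move=> Omega AO; rewrite -EFinM /= lee_fin.
have lik0 : 0 <= lik Omega / lik_mass A by rewrite divr_ge0 ?expR_ge0 // ltW.
rewrite (mulrAC (expR (`|t| * M))) -(mulrA (expR (`|t| * M))) [leLHS]normrM [leRHS]normrM (ger0_norm lik0).
rewrite !(ger0_norm (expR_ge0 _)) ler_wpM2r //.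
rewrite ler_expR; apply: le_trans (ler_norm _) _; rewrite normrM.
by rewrite ler_wpM2l // HM.
Qed.

Lemma mean_functional_restricted : mean_functional restricted_mean.
Proof.
apply: mean_functional_weighted => //.
- by apply: measurable_funS measurable_linear_stat => //; exact: measurable_posdefmx.
- by apply: measurable_funM => //; apply: measurable_funTS; exact: measurable_lik.
- by move=> Omega _; rewrite divr_ge0 ?expR_ge0 // ltW.
- exact: integrable_exp_linear_stat.
- have [_ _ e] := lik_mass_gt0 mass0.
  under eq_integral do rewrite EFinM.
  rewrite integralZr //; last exact: integrable_lik.
  by rewrite [X in (X * _)%E]e -EFinM mulfV // gt_eqF.
Qed.

(** By the local expansion the likelihood at the shifted matrix is
    [exp (t V - t ^ 2 / 2)] times the likelihood, up to a factor between
    [exp (- eta)] and [exp eta]; integrating over [A] turns the ratio of shifted to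
    unshifted mass into the moment generating function. *)
Lemma restricted_mgf_close (t eta rho : R) :
  4 * `|t| <= Num.sqrt n%:R ->
  t ^+ 2 / 2 * kappa + 8 * `|t| ^+ 3 / Num.sqrt n%:R <= eta ->
  `|fine (lik_integral n Pi S
      (fun Omega => Omega + (Num.sqrt 2 * t / (Num.sqrt n%:R * s)) *: Phi) A)
    / lik_mass A - 1| <= rho ->
  `|mgf restricted_mean t - expR (t ^+ 2 / 2)|
    <= expR (t ^+ 2 / 2) * (expR eta * (1 + rho) - 1).
Proof.
move=> tn teta; set I := lik_integral _ _ _ _ _; set r := _ / _ => Hr.
set h := (Num.sqrt 2 * t / (Num.sqrt n%:R * s)) in I r Hr.
have HL Omega : A Omega ->
    expR (- eta) * lik (Omega + h *: Phi) <=
      expR (t * linear_stat Omega) * lik Omega * expR (- (t ^+ 2 / 2)) <=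
      expR eta * lik (Omega + h *: Phi).
  move=> AO.
  have := loglik_expansion Spos PhiT S (Apos AO) Phi0 n0 (trace_close AO) kappa1 tn.
  rewrite -/s -/(linear_stat Omega) -/h => H; have {H} := le_trans H teta.
  rewrite /lik -!expRD !ler_expR ler_norml => /andP[H1 H2].
  by apply/andP; split; lra.
have iE : (Pi : measure _ R).-integrable (A : set (borel_mx R p p))
    (fun Omega => (expR (t * linear_stat Omega) * lik Omega * expR (- (t ^+ 2 / 2)))%:E).
  have := integrableZl mA (lik_mass A * expR (- (t ^+ 2 / 2))) (integrable_exp_linear_stat t).
  apply: eq_integrable => // Omega _; rewrite -EFinM; congr EFin.
  by field; rewrite gt_eqF.
have iS : (Pi : measure _ R).-integrable (A : set (borel_mx R p p))
    (EFin \o (fun Omega => lik (Omega + h *: Phi))).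
  apply: (le_integrable _ _ _ (integrableZl mA (expR eta) iE)) => //.
    apply/measurable_EFinP; apply: measurable_funTS; exact: measurable_lik_shift.
  move=> Omega AO; rewrite -EFinM /= lee_fin.
  rewrite !ger0_norm ?mulr_ge0 ?expR_ge0 //.
  rewrite -ler_pdivrMl ?expR_gt0 // -expRN.
  by have /andP[] := HL _ AO.
have IE : fine I = (\int[Pi]_(Omega in (A : set (borel_mx R p p))) lik (Omega + h *: Phi))%R.
  by [].
pose m := mgf restricted_mean t * expR (- (t ^+ 2 / 2)).
have mE : m = (\int[Pi]_(Omega in (A : set (borel_mx R p p)))
    (expR (t * linear_stat Omega) * lik Omega * expR (- (t ^+ 2 / 2))))%R / lik_mass A.
  rewrite /m /mgf /restricted_mean /weighted_mean.
  rewrite -[RHS]RintegralZr // -RintegralZr //; last exact: (integrable_exp_linear_stat t).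
  by apply: eq_Rintegral => Omega _; field; rewrite gt_eqF.
have mle : m <= expR eta * r.
  rewrite mE /r mulrA ler_pM2r ?invr_gt0 // IE -RintegralZl //.
  apply: le_Rintegral => // [|Omega AO]; last by have /andP[] := HL _ AO.
  exact: (integrableZl mA (expR eta) iS).
have mge : expR (- eta) * r <= m.
  rewrite mE /r mulrA ler_pM2r ?invr_gt0 // IE -RintegralZl //.
  apply: le_Rintegral => // [|Omega AO]; last by have /andP[] := HL _ AO.
  exact: (integrableZl mA (expR (- eta)) iS).
have -> : mgf restricted_mean t - expR (t ^+ 2 / 2) = expR (t ^+ 2 / 2) * (m - 1).
  rewrite /m mulrBr mulr1 mulrCA -expRD subrr expR0 mulr1; ring.
rewrite normrM (ger0_norm (expR_ge0 _)) ler_wpM2l ?expR_ge0 //.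
have e1 := expR_gt0 eta; have e2 := expR_gt0 (- eta).
have e3 := expRxMexpNx_1 eta.
move: Hr; rewrite !ler_norml => /andP[r1 r2].
have rho0 : 0 <= rho by lra.
have eta0 : 0 <= eta.
  have [Om AO] : A !=set0.
    apply/set0P/eqP => A0; move: mass0; rewrite /lik_mass /lik_integral A0.
    by rewrite integral_set0 ltxx.
  apply: le_trans teta; rewrite addr_ge0 //.
  rewrite mulr_ge0 ?divr_ge0 ?sqr_ge0 //.
  have s0 : 0 < s ^+ 2 by rewrite exprn_gt0 // (scale_gt0 Spos Phi0).
  by rewrite -(pmulr_lge0 _ s0); exact: le_trans (trace_close AO).
have e4 : 1 <= expR eta by rewrite -expR0 ler_expR.
have e5 : expR (- eta) <= 1 by rewrite -expR0 ler_expR oppr_le0.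
have e6 : 2 <= expR eta + expR (- eta).
  have : 0 <= (expR eta - 1) * (1 - expR (- eta)) by rewrite mulr_ge0; lra.
  by rewrite mulrBr mulr1 mulrBl e3; lra.
apply/andP; split; last first.
  by apply: lerB => //; apply: le_trans mle _; rewrite ler_wpM2l ?expR_ge0 //; lra.
have : expR (- eta) * (1 - rho) <= m.
  by apply: le_trans mge; rewrite ler_wpM2l ?expR_ge0 //; lra.
have : expR (- eta) * rho <= expR eta * rho by rewrite ler_wpM2r //; lra.
rewrite !mulrDr !mulr1 mulrN; lra.
Qed.

Section Posterior.
Variables (W : 'M[R]_p -> R) (tau eps1 eps2 : R).
Hypotheses (mW : measurable_fun (@posdefmx R p : set (borel_mx R p p))
    (W : borel_mx R p p -> R))
  (WV : forall Omega, A Omega -> `|W Omega - linear_stat Omega| <= tau)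
  (total0 : 0 < lik_mass (@posdefmx R p))
  (postA : `|1 - posterior n Pi S A| <= eps1)
  (cdf_close : forall c, `|cdf_of restricted_mean c - cdf_of (@gaussian_mean R) c| <= eps2).

(** On [A] the event [W <= c] lies between [V <= c - tau] and [V <= c + tau]; the
    part outside [A] has posterior mass at most [eps1], and so does the loss from
    normalizing by the mass of [A] instead of the total mass. *)
Lemma posterior_cdf_close c :
  `|posterior n Pi S [set Omega | posdefmx Omega /\ W Omega <= c] - std_normal_cdf c|
    <= eps1 + eps2 + tau.
Proof.
set B := [set Omega | _].
have mB : measurable (B : set (borel_mx R p p)).
  rewrite (_ : B = @posdefmx R p `&` W @^-1` `]-oo, c]%classic); last first.
    by apply/seteqP; split => Omega; rewrite /B /= in_itv.
  by apply: mW; [exact: measurable_posdefmx|exact: measurable_itv].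
pose D := lik_mass (@posdefmx R p); pose Z := lik_mass A.
have tot0 : 0 < D := total0; have Z0 : 0 < Z := mass0.
have mpos := @measurable_posdefmx R p.
have ipos := integrable_lik mpos total0.
have isub B' : measurable (B' : set (borel_mx R p p)) -> B' `<=` @posdefmx R p ->
    (Pi : measure _ R).-integrable (B' : set (borel_mx R p p)) (EFin \o lik).
  by move=> mB' sub; exact: integrableS ipos.
pose m (B' : set 'M[R]_p) : R := (\int[Pi]_(Omega in (B' : set (borel_mx R p p))) lik Omega)%R.
have massU B1 B2 : measurable (B1 : set (borel_mx R p p)) ->
    measurable (B2 : set (borel_mx R p p)) -> B1 `<=` @posdefmx R p ->
    B2 `<=` @posdefmx R p -> [disjoint B1 & B2] -> m (B1 `|` B2) = m B1 + m B2.
  move=> m1 m2 s1 s2 dis; apply: Rintegral_setU => //.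
  by apply: isub; [exact: measurableU|rewrite subUset].
have m0 B' : 0 <= m B' by apply: Rintegral_ge0 => *; exact: expR_ge0.
have DE : D = m (@posdefmx R p) by [].
have ZE : Z = m A by [].
have split_at B1 : measurable (B1 : set (borel_mx R p p)) -> B1 `<=` @posdefmx R p ->
    m B1 = m (B1 `&` A) + m (B1 `\` A).
  move=> m1 s1; rewrite -massU ?setUIDK //.
  - exact: measurableI.
  - exact: measurableD.
  - by move=> Omega [/s1].
  - by move=> Omega [/s1].
  - by rewrite disj_set2E; apply/eqP/seteqP; split=> Omega //= -[[_ ?] [_ ?]].
have Bpos : B `<=` @posdefmx R p by move=> Omega [].
have mono B1 B2 : measurable (B1 : set (borel_mx R p p)) ->
    measurable (B2 : set (borel_mx R p p)) -> B1 `<=` B2 ->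
    B2 `<=` @posdefmx R p -> m B1 <= m B2.
  move=> m1 m2 sub s2; rewrite -(setDUK sub) massU ?lerDl //.
  - exact: measurableD.
  - exact: subset_trans s2.
  - by move=> Omega [/s2].
  - by rewrite disj_set2E; apply/eqP/seteqP; split=> Omega //= -[? [_ ?]].
have mVA := measurable_funS mpos Apos measurable_linear_stat.
have mV b : measurable ([set Omega | linear_stat Omega <= b] `&` A : set (borel_mx R p p)).
  rewrite (_ : _ `&` _ = A `&` linear_stat @^-1` `]-oo, b]%classic); last first.
    by rewrite setIC; congr (_ `&` _); apply/seteqP; split => Omega; rewrite /= in_itv.
  by apply: mVA => //; exact: measurable_itv.
have mwt : measurable_fun (A : set (borel_mx R p p)) (fun Omega => lik Omega / Z).
  by apply: measurable_funM => //; apply: measurable_funTS; exact: measurable_lik.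
have wt0 Omega : A Omega -> 0 <= lik Omega / Z by rewrite divr_ge0 ?expR_ge0 // ltW.
have cdfE b : cdf_of restricted_mean b * Z = m ([set Omega | linear_stat Omega <= b] `&` A).
  rewrite /cdf_of /restricted_mean /weighted_mean -RintegralZr //; last first.
    exact: (integrable_weighted mA mVA mwt wt0 integrable_exp_linear_stat (exp_growth_cdf b)).
  rewrite setIC /m Rintegral_mkcondr; apply: eq_Rintegral => Omega _.
  rewrite patchE; have [Vb|Vb] := leP (linear_stat Omega) b.
    by rewrite mem_set // mul1r divfK // gt_eqF.
  by rewrite memNset ?mul0r // => /=; rewrite leNgt Vb.
have up : m (B `&` A) <= cdf_of restricted_mean (c + tau) * Z.
  rewrite cdfE; apply: mono => //; first exact: measurableI.
    move=> Omega [[_ Wc] AO]; split=> //=; have := WV AO.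
    by rewrite ler_norml => /andP[h1 h2]; lra.
  by move=> Omega [_ /Apos].
have lo : cdf_of restricted_mean (c - tau) * Z <= m (B `&` A).
  rewrite cdfE; apply: mono => //; first exact: measurableI.
    move=> Omega [/= Vc AO]; split=> //; split; first exact: Apos.
    by have := WV AO; rewrite ler_norml => /andP[h1 h2]; lra.
  by move=> Omega [_ /Apos].
have rest : m (B `\` A) <= D - Z.
  rewrite DE ZE (split_at _ mpos) // (setIidr Apos) addrAC subrr add0r.
  apply: mono; [exact: measurableD|exact: measurableD|exact: setSD|].
  by move=> Omega [].
have restge := m0 (B `\` A).
have ZD : Z <= D by rewrite DE ZE mono.
have postAE : posterior n Pi S A = Z / D by [].
have postBE : posterior n Pi S B = (m (B `&` A) + m (B `\` A)) / D by rewrite -split_at.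
have := postA; rewrite postAE ler_norml => /andP[_ piA].
have Fup := cdf_close (c + tau); have Flo := cdf_close (c - tau).
have tau0 : 0 <= tau.
  have [Om AO] : A !=set0.
    apply/set0P/eqP => A0; move: mass0; rewrite /lik_mass /lik_integral A0.
    by rewrite integral_set0 ltxx.
  exact: le_trans (WV AO).
have G1 := cdf_gaussian_lipschitz c tau0.
have G2 := cdf_gaussian_lipschitz (c - tau) tau0.
rewrite subrK in G2; rewrite -cdf_gaussian.
have E1 := cdf_of_le1 mean_functional_restricted (c - tau).
have E2 := cdf_of_ge0 mean_functional_restricted (c + tau).
have D0 : D != 0 by rewrite gt_eqF.
have upB : posterior n Pi S B <= cdf_of restricted_mean (c + tau) + eps1.
  rewrite postBE mulrDl; apply: lerD.
    rewrite ler_pdivrMr //; apply: le_trans up _; rewrite ler_wpM2l //.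
  apply: le_trans piA; rewrite -(divff D0) -mulrBl ler_pM2r ?invr_gt0 //.
have loB : cdf_of restricted_mean (c - tau) - eps1 <= posterior n Pi S B.
  apply: (@le_trans _ _ (cdf_of restricted_mean (c - tau) * (Z / D))); last first.
    by rewrite postBE mulrA ler_pM2r ?invr_gt0 //; lra.
  have : cdf_of restricted_mean (c - tau) * (1 - Z / D) <= 1 * (1 - Z / D).
    by rewrite ler_wpM2r // subr_ge0 ler_pdivrMr // mul1r.
  by rewrite mulrBr mulr1 mul1r; lra.
move: Fup Flo; rewrite !ler_norml => /andP[f1 f2] /andP[f3 f4].
by apply/andP; split; lra.
Qed.

End Posterior.
End Bounded.
End FixedSample.

(** A spectral ball is bounded in Frobenius norm, by its radius times the norm of
    the identity. *)
Lemma linear_stat_bounded (R : realType) p n (SigmaStar Phi S : 'M[R]_p)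
    (A : set 'M[R]_p) (delta : R) :
  A `<=` [set Omega | spectral_norm (invmx Omega - SigmaStar) <= delta] ->
  exists M, forall Omega, A Omega -> `|linear_stat n SigmaStar Phi S Omega| <= M.
Proof.
move=> AO.
pose K := `|delta| * frobenius_norm (1%:M : 'M[R]_p) * frobenius_norm Phi
  + `|\tr ((SigmaStar - S) *m Phi)|.
rewrite /linear_stat; set c := Num.sqrt 2 * _; set rn := Num.sqrt _.
exists (rn * K / `|c|) => Omega /AO /= le_delta.
rewrite normrM normfV normrM (ger0_norm (sqrtr_ge0 _)) -/rn.
rewrite ler_wpM2r ?invr_ge0 // ler_wpM2l ?sqrtr_ge0 //.
rewrite (_ : invmx Omega - S = (invmx Omega - SigmaStar) + (SigmaStar - S)); last first.
  by rewrite addrA subrK.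
rewrite mulmxDl raddfD /=; apply: le_trans (ler_normD _ _) _; rewrite lerD2r.
set E := invmx Omega - SigmaStar in le_delta *.
rewrite -[E]trmxK; apply: le_trans (frobenius_CauchySchwarz _ _) _.
rewrite frobenius_norm_tr ler_wpM2r ?frobenius_norm_ge0 //.
rewrite -{1}[E]mulmx1; apply: frobenius_norm_mul_le => // x.
apply: le_trans (mulmx_spectral_norm _ _) _.
rewrite ler_wpM2r ?frobenius_norm_ge0 //; exact: le_trans le_delta (ler_norm _).
Qed.

Lemma lik_mass_ge0 (R : realType) p n (S : 'M[R]_p)
  (Pi : probability (borel_mx R p p) R) B : 0 <= lik_mass n S Pi B.
Proof. by apply/fine_ge0/integral_ge0 => Omega _; rewrite lee_fin expR_ge0. Qed.

(** Tolerances for the expansion ([eta]) and for the ratio of integrals ([rho])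
    that make [restricted_mgf_close] conclude within [delta]. *)
Lemma expR_slack (R : realType) (K delta : R) : 0 < K -> 0 < delta ->
  exists eta rho : R, [/\ 0 < eta, 0 < rho & K * (expR eta * (1 + rho) - 1) <= delta].
Proof.
move=> K0 d0; pose a := Num.min 1 (delta / K / 3).
have a0 : 0 < a by rewrite lt_min ltr01 !divr_gt0.
have a1 : a <= 1 by rewrite ge_min lexx.
have a3 : 3 * a <= delta / K.
  by rewrite mulrC -ler_pdivlMr // ge_min lexx orbT.
exists (ln (1 + a)), a; split=> //; first by rewrite ln_gt0 // ltrDl.
rewrite lnK ?posrE ?addr_gt0 // mulrC -ler_pdivlMr //; apply: le_trans a3; nra.
Qed.

Lemma near_sqrt_ge (R : realType) (M : R) : \forall n \near \oo, M <= Num.sqrt (n%:R : R).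
Proof.
near=> n.
have nM : ((Num.truncn (M ^+ 2)).+1 <= n)%N by near: n; exact: nbhs_infty_ge.
apply: le_trans (ler_norm M) _; rewrite -sqrtr_sqr ler_wsqrtr //.
by apply: (le_trans (ltW (truncnS_gt _))); rewrite ler_nat.
Unshelve. all: by end_near.
Qed.

(** * The theorem *)

Theorem theorem2p1 (R : realType)
  (p : nat -> nat) (hp : p @ \oo --> \oo)
  (d : nat -> measure_display) (T : forall n, measurableType (d n))
  (P : forall n, probability (T n) R)
  (SigmaStar : forall n, 'M[R]_(p n))
  (hSigmaStar : forall n, posdefmx (SigmaStar n))
  (X : forall n, 'I_n -> T n -> 'cV[R]_(p n))
  (hX : forall n, iid_gaussian (P n) (SigmaStar n) (X n))
  (phi : forall n, 'M[R]_(p n) -> R)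
  (hphi : forall n, measurable_fun
     (@posdefmx R (p n) : set (borel_mx R (p n) (p n)))
     (phi n : borel_mx R (p n) (p n) -> R))
  (hbounded : exists C : R, \forall n \near \oo,
     Num.max (spectral_norm (SigmaStar n)) (spectral_norm (invmx (SigmaStar n))) <= C)
  (Pi : forall n, probability (borel_mx R (p n) (p n)) R)
  (hPi : forall n, Pi n (@posdefmx R (p n)) = 1%E)
  (A : forall n, set 'M[R]_(p n))
  (hAmeas : forall n, measurable (A n : set (borel_mx R (p n) (p n))))
  (hApos : forall n, A n `<=` @posdefmx R (p n))
  (delta : nat -> R) (hdelta : delta @ \oo --> 0)
  (hAdelta : forall n,
     A n `<=` [set Omega | spectral_norm (invmx Omega - SigmaStar n) <= delta n])
  (Phi : forall n, 'M[R]_(p n))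
  (hPhisym : forall n, (Phi n)^T = Phi n)
  (hPhi0 : forall n, Phi n != 0) :
  let SigmaHat n (w : T n) := sample_covariance (fun i => X n i w) in
  let scale n :=
    frobenius_norm (mxsqrt (SigmaStar n) *m Phi n *m mxsqrt (SigmaStar n)) in
  oP1 P (fun n w =>
    ereal_sup [set (Num.sqrt n%:R * (scale n)^-1 *
      `| phi n (invmx Omega) - phi n (SigmaHat n w)
         - \tr ((invmx Omega - SigmaHat n w) *m Phi n) |)%:E | Omega in A n]) ->
  oP1 P (fun n w => (1 - posterior n (Pi n) (SigmaHat n w) (A n))%:E) ->
  (forall t : R, oP1 P (fun n w =>
    (fine (lik_integral n (Pi n) (SigmaHat n w)
             (fun Omega => Omega
                + (Num.sqrt 2 * t / (Num.sqrt n%:R * scale n)) *: Phi n) (A n))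
     / fine (lik_integral n (Pi n) (SigmaHat n w) id (A n)) - 1)%:E)) ->
  oP1 P (fun n w =>
    ereal_sup [set `| posterior n (Pi n) (SigmaHat n w)
        [set Omega | posdefmx Omega /\
           Num.sqrt n%:R * (phi n (invmx Omega) - phi n (SigmaHat n w))
           / (Num.sqrt 2 * scale n) <= t]
      - std_normal_cdf t |%:E | t in [set: R]]).
Proof.
move=> SigmaHat scale Hlin Hpost Hlap eps eps0.
pose tau := eps / 4; have tau0 : 0 < tau by rewrite divr_gt0.
pose eps1 := Num.min 2^-1 tau.
have eps10 : 0 < eps1 by rewrite lt_min invr_gt0 ltr0n.
have eps1h : eps1 <= 2^-1 by rewrite ge_min lexx.
have eps1t : eps1 <= tau by rewrite ge_min lexx orbT.
have GE := @mean_functional_gaussian R.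
have [ts [del [del0 Hdel]]] := mgf_determines_cdf GE (@cdf_gaussian_lipschitz R) tau0.
pose E n (w : T n) := restricted_mean n (SigmaStar n) (Phi n) (SigmaHat n w) (A n) (Pi n).
(* Off this event the posterior mass of [A n] is at least [1/2], so both
   integrals defining it are finite and positive. *)
pose badpost n := [set w | (eps1%:E < `|(1 - posterior n (Pi n) (SigmaHat n w) (A n))%:E|)%E].
have mass n w : ~ badpost n w ->
    [/\ `|1 - posterior n (Pi n) (SigmaHat n w) (A n)| <= eps1,
        0 < lik_mass n (SigmaHat n w) (Pi n) (A n) &
        0 < lik_mass n (SigmaHat n w) (Pi n) (@posdefmx R (p n))].
  move=> /negP; rewrite -leNgt /= lee_fin => H.
  have : 0 < posterior n (Pi n) (SigmaHat n w) (A n).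
    by move: H; rewrite ler_norml => /andP[_]; lra.
  rewrite /posterior -!/(lik_mass _ _ _ _) => post0; split => //.
    rewrite lt_def lik_mass_ge0 andbT; apply: contraTneq post0 => ->.
    by rewrite mul0r ltxx.
  rewrite lt_def lik_mass_ge0 andbT; apply: contraTneq post0 => ->.
  by rewrite invr0 mulr0 ltxx.
have [C HC] := hbounded.
pose C1 := Num.max C 0; have C10 : 0 <= C1 by rewrite le_max lexx orbT.
(* The relative error of [tr (Sigma Phi Sigma Phi)]. The absolute value is for
   indices where [delta n] is negative, for which [A n] is empty. *)
pose kappa n := 2 * (C1 * `|delta n|) + (C1 * `|delta n|) ^+ 2.
have kappa_ge0 n : 0 <= kappa n.
  by rewrite /kappa addr_ge0 ?sqr_ge0 // mulr_ge0 // mulr_ge0.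
have kappa_small (z : R) : 0 < z -> \forall n \near \oo, kappa n <= z.
  move=> z0; pose y := Num.min 1 (z / 3) / (C1 + 1).
  have y0 : 0 < y by rewrite divr_gt0 ?lt_min ?ltr01 ?divr_gt0 // ltr_pwDr.
  have /cvgrPdist_le/(_ y y0) := hdelta; apply: filterS => n.
  rewrite sub0r normrN => dy; rewrite /kappa; set x := C1 * _.
  have x0 : 0 <= x by rewrite mulr_ge0.
  have : x <= Num.min 1 (z / 3).
    apply: (@le_trans _ _ (C1 * y)); first by rewrite ler_wpM2l.
    rewrite /y mulrCA ler_piMr //; first by rewrite le_min ler01 divr_ge0 // ltW.
    by rewrite ler_pdivrMr ?ltr_pwDr // mul1r lerDl.
  by rewrite le_min => /andP[x1 x3]; nra.
have trace_near : \forall n \near \oo, forall Omega, A n Omega ->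
    let Sigma := invmx Omega in
    `|\tr (Sigma *m Phi n *m Sigma *m Phi n) - scale n ^+ 2| <= kappa n * scale n ^+ 2.
  apply: filterS HC => n; rewrite ge_max => /andP[_ HCn] Omega AO.
  apply: trace_quadratic_perturb => //.
    by apply: le_trans HCn _; rewrite le_max lexx.
  by have := hAdelta n Omega AO => /le_trans; apply; exact: ler_norm.
have n_pos : \forall n \near \oo, (0 < n)%N by exact: nbhs_infty_gt.
have vmgf t : vanishing P
    (fun n => [set w | ~ badpost n w /\ del < `|mgf (E n w) t - mgf (@gaussian_mean R) t|]).
  have [eta [rho [eta0 rho0 Hslack]]] := expR_slack (expR_gt0 (t ^+ 2 / 2)) del0.
  apply: (vanishing_sub _ (Hlap t rho rho0)).
  have z0 : 0 < Num.min 1 (eta / (t ^+ 2 + 1)).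
    by rewrite lt_min ltr01 divr_gt0 // ltr_pwDr // sqr_ge0.
  near=> n => w [/mass[_ mA0 _] far] /=.
  rewrite ltNge lee_fin; apply/negP => close; move: far; apply/negP; rewrite -leNgt.
  have kn : kappa n <= Num.min 1 (eta / (t ^+ 2 + 1)) by near: n; exact: kappa_small.
  have [k1 k2] : kappa n <= 1 /\ kappa n <= eta / (t ^+ 2 + 1).
    by move: kn; rewrite le_min => /andP[].
  have rn1 : 4 * `|t| <= Num.sqrt n%:R by near: n; exact: near_sqrt_ge.
  have rn2 : 16 * `|t| ^+ 3 / eta <= Num.sqrt n%:R by near: n; exact: near_sqrt_ge.
  have n0 : (0 < n)%N by near: n.
  have trn : forall Omega, A n Omega -> let Sigma := invmx Omega in
      `|\tr (Sigma *m Phi n *m Sigma *m Phi n) - scale n ^+ 2| <= kappa n * scale n ^+ 2.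
    by near: n.
  rewrite mgf_gaussian; apply: le_trans Hslack.
  have Lbd := @linear_stat_bounded R (p n) n _ (Phi n) (SigmaHat n w) _ _ (hAdelta n).
  apply: (restricted_mgf_close (hSigmaStar n) (hPhisym n) (hPhi0 n) n0 (hAmeas n)
    (hApos n) mA0 Lbd k1 trn rn1 _ close).
  have rn0 : 0 < Num.sqrt (n%:R : R) by rewrite sqrtr_gt0 ltr0n.
  rewrite [leRHS](splitr eta) lerD //.
    rewrite mulrAC ler_wpM2r ?invr_ge0 //.
    move: k2; rewrite ler_pdivlMr; last by rewrite ltr_pwDr // sqr_ge0.
    apply: le_trans; rewrite mulrC mulrDr mulr1 lerDl.
    exact: kappa_ge0.
  rewrite ler_pdivrMr //; move: rn2; rewrite ler_pdivrMr //; lra.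
pose bad := fun n => [set w | (tau%:E < `|ereal_sup [set (Num.sqrt n%:R * (scale n)^-1 *
      `| phi n (invmx Omega) - phi n (SigmaHat n w)
         - \tr ((invmx Omega - SigmaHat n w) *m Phi n) |)%:E | Omega in A n]|)%E]
  `|` badpost n `|` [set w | exists2 t, t \in ts &
        ~ badpost n w /\ del < `|mgf (E n w) t - mgf (@gaussian_mean R) t|].
have vbad : vanishing P bad.
  apply: vanishingU; first apply: vanishingU.
  - exact: Hlin.
  - exact: Hpost.
  - apply: (@vanishing_bigcup_seq _ _ _ _ _ ts (fun t n => [set w | ~ badpost n w /\
      del < `|mgf (E n w) t - mgf (@gaussian_mean R) t|])) => t _; exact: vmgf.
apply: vanishing_sub vbad; near=> n => w /=; apply: contraPP => /= good.
have n0 : (0 < n)%N by near: n.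
have trn : forall Omega, A n Omega -> let Sigma := invmx Omega in
    `|\tr (Sigma *m Phi n *m Sigma *m Phi n) - scale n ^+ 2| <= kappa n * scale n ^+ 2.
  by near: n.
have k1 : kappa n <= 1 by near: n; exact: kappa_small.
have goodpost : ~ badpost n w by move=> b; apply: good; left; right.
have [post1 mA0 mD0] := mass n w goodpost.
have goodmgf : mgf_close ts del (E n w) (@gaussian_mean R).
  move=> t tts; rewrite leNgt; apply/negP => far.
  by apply: good; right; exists t.
have Lbd := @linear_stat_bounded R (p n) n _ (Phi n) (SigmaHat n w) _ _ (hAdelta n).
have EE : mean_functional (E n w).
  exact: (mean_functional_restricted (hAmeas n) (hApos n) mA0 Lbd).
have cdfc := Hdel _ EE goodmgf.
have s0 : 0 < scale n by exact: scale_gt0 (hSigmaStar n) (hPhi0 n).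
pose W (Omega : 'M[R]_(p n)) := Num.sqrt n%:R * (phi n (invmx Omega) - phi n (SigmaHat n w))
  / (Num.sqrt 2 * scale n).
have mW : measurable_fun (@posdefmx R (p n) : set (borel_mx R (p n) (p n)))
    (W : borel_mx R (p n) (p n) -> R).
  apply: measurable_funM => //; apply: measurable_funM => //.
  apply: measurable_funB => //.
  apply: (@measurable_comp _ _ _ (borel_mx R (p n) (p n)) (borel_mx R (p n) (p n)) _
     (@posdefmx R (p n)) (phi n)) => //.
  - exact: measurable_posdefmx.
  - by move=> ? [Om Om_pos <-]; exact: posdefmx_inv.
  - exact: measurable_invmx_posdef.
have WV Omega : A n Omega ->
    `|W Omega - linear_stat n (SigmaStar n) (Phi n) (SigmaHat n w) Omega| <= tau.
  move=> AO; set x := phi n (invmx Omega) - phi n (SigmaHat n w).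
  set y := \tr ((invmx Omega - SigmaHat n w) *m Phi n).
  have le_tau : Num.sqrt n%:R * (scale n)^-1 * `|x - y| <= tau.
    rewrite leNgt; apply/negP => far; apply: good; left; left => /=.
    apply: (lt_le_trans _ (lee_abs _)); rewrite -lte_fin in far.
    by apply: (lt_le_trans far); apply: ereal_sup_ubound; exists Omega.
  rewrite /W /linear_stat -/(scale n) -/x -/y -mulrBl -mulrBr.
  rewrite normrM normfV normrM (ger0_norm (sqrtr_ge0 _)).
  rewrite (gtr0_norm (mulr_gt0 _ s0)) ?sqrtr_gt0 // invfM.
  apply: le_trans le_tau; rewrite -!mulrA ler_wpM2l ?sqrtr_ge0 //.
  rewrite [leRHS]mulrC ler_wpM2l // ler_piMl ?invr_ge0 ?(ltW s0) //.
  by rewrite invf_le1 ?sqrtr_gt0 // -[leLHS]sqrtr1 ler_wsqrtr // ler1n.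
have close c := posterior_cdf_close (hAmeas n) (hApos n) mA0 Lbd mW WV mD0 post1 cdfc c.
apply/negP; rewrite -leNgt.
have sup_le : (ereal_sup [set `| posterior n (Pi n) (SigmaHat n w)
        [set Omega | posdefmx Omega /\ W Omega <= t]
      - std_normal_cdf t |%:E | t in [set: R]] <= eps%:E)%E.
  apply: ge_ereal_sup => _ [c _ <-]; rewrite lee_fin; apply: le_trans (close c) _.
  by rewrite /tau in eps1t *; lra.
rewrite gee0_abs //.
apply: (le_trans _ (ereal_sup_ubound _)); last by exists 0.
by rewrite lee_fin.
Unshelve. all: by end_near.
Qed.
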